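(* Let $K$ be a finite simplicial complex, let $|K|$ be its geometric realization, and let $\alpha>0$ be a computable real number. Consider equations in the fixed list of operation symbols $F_i$ ($i\in\omega$), which contains each arity infinitely often. Then the set of finite sets $\Sigma$ of such equations with $\lambda_{|K|}(\Sigma)<\alpha$ is recursively enumerable.
   Context: Equations and $\lambda$. Terms are built from variables $x_0,x_1,\dots$ and the operation symbols; an equation $\sigma\approx\tau$ is an ordered pair of terms. An algebra $\mathbf A=(A;\overline F_i)$ has operations $\overline F_i:A^{n_i}\to A$; each term $\sigma$ yields a term operation $\sigma^{\mathbf A}:A^\omega\to A$. For a nonempty metric space $(A,d)$ put $\lambda_{\mathbf A}(\Sigma)=\sup\{d(\sigma^{\mathbf A}(\mathbf a),\tau^{\mathbf A}(\mathbf a)):\sigma\approx\tau\in\Sigma,\ \mathbf a\in A^\omega\}$ (sup of the empty set is $0$), and $\lambda_A(\Sigma)=\inf\lambda_{\mathbf A}(\Sigma)$ over all algebras $\mathbf A$ on $A$ whose operations are continuous. The list $F_i$ ($i\in\omega$) of operation symbols has a recursive arity function $i\mapsto n_i$, and every arity occurs infinitely often; finite sets of equations in these symbols are coded by natural numbers in a standard effective way. A finite simplicial complex $K$ is a finite family of nonempty finite sets closed under nonempty subsets, with vertex set $V=\bigcup K$; $|K|$ is the set of $\beta\in[0,1]^V$ with $\sum_v\beta_v=1$ and $\{v:\beta_v>0\}\in K$, with the Euclidean metric $d(\beta,\gamma)=\sqrt{\sum_v(\beta_v-\gamma_v)^2}$. A real $\alpha$ is computable in the usual sense; all that is needed is that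 there is an algorithm deciding $s\alpha>r$ for positive integers $r,s$. *)

(* Defs.v *)
From HB Require Import structures.
From mathcomp Require Import all_boot all_order all_algebra finmap.
From mathcomp Require Import all_classical all_reals all_analysis.
From mathcomp Require Import ring lra.

Set Implicit Arguments.
Unset Strict Implicit.
Unset Printing Implicit Defensive.

Import Order.TTheory GRing.Theory Num.Theory.

Local Open Scope classical_set_scope.
Local Open Scope ring_scope.

(** * Recursive functions *)

(* The total recursive functions: the primitive recursive schemes together with
   minimisation of regular functions.  [recursive_ext] only makes the class
   extensional. *)
Inductive recursive : forall k, (k.-tuple nat -> nat) -> Prop :=
| recursive_ext k (f g : k.-tuple nat -> nat) :
    f =1 g -> recursive f -> recursive g
| recursive_zero : recursive (fun _ : 0.-tuple nat => 0%N)
| recursive_succ : recursive (fun x : 1.-tuple nat => (thead x).+1)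
| recursive_proj k (i : 'I_k) : recursive (fun x : k.-tuple nat => tnth x i)
| recursive_comp k m (f : m.-tuple nat -> nat) (g : 'I_m -> k.-tuple nat -> nat) :
    recursive f -> (forall i, recursive (g i)) ->
    recursive (fun x : k.-tuple nat => f [tuple g i x | i < m])
| recursive_primrec k (f : k.-tuple nat -> nat) (g : k.+2.-tuple nat -> nat) :
    recursive f -> recursive g ->
    recursive (fun x : k.+1.-tuple nat =>
      nat_rect (fun=> nat) (f (behead_tuple x))
        (fun n r => g [tuple of n :: r :: behead_tuple x]) (thead x))
| recursive_min k (f : k.+1.-tuple nat -> nat)
    (regular : forall x : k.-tuple nat, exists n, f [tuple of n :: x] == 0%N) :
    recursive f -> recursive (fun x : k.-tuple nat => ex_minn (regular x)).

Definition recursive1 (f : nat -> nat) : Prop :=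
  recursive (fun x : 1.-tuple nat => f (thead x)).

Definition recursively_enumerable (P : set nat) : Prop :=
  exists2 f : 2.-tuple nat -> nat, recursive f &
    forall n, P n <-> exists m, f [tuple n; m] = 0%N.

(* Signs and denominators: the approximating rationals are
   (p n - q n) / (r n + 1). *)
Definition computable_real (R : realType) (alpha : R) : Prop :=
  exists p q r : nat -> nat,
    [/\ recursive1 p, recursive1 q, recursive1 r &
        forall n, `| ((p n)%:R - (q n)%:R) / (r n).+1%:R - alpha | <= 2 ^- n].

(** * Terms and equations *)

Inductive term (ar : nat -> nat) :=
| Var of nat
| App (i : nat) of {ffun 'I_(ar i) -> term ar}.

Arguments Var {ar} _.
Arguments App {ar} i _.

Fixpoint code_term ar (t : term ar) : nat :=
  match t with
  | Var k => CodeSeq.code [:: 0; k]%N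
  | App i ts =>
      CodeSeq.code (i.+1 :: [seq code_term (ts j) | j <- enum 'I_(ar i)])%N
  end.

Fixpoint term_ind' ar (P : term ar -> Prop) (PVar : forall k, P (Var k))
    (PApp : forall i (ts : {ffun 'I_(ar i) -> term ar}),
       (forall j, P (ts j)) -> P (App i ts)) (t : term ar) : P t :=
  match t with
  | Var k => PVar k
  | App i ts => PApp i ts (fun j => term_ind' PVar PApp (ts j))
  end.

Lemma code_term_inj ar : injective (@code_term ar).
Proof.
elim/term_ind' => [k|i ts IH] [k'|i' ts'] /(can_inj CodeSeq.codeK) // [].
  by move=> ->.
move=> eqi; subst i' => /eq_in_map eqts; congr App.
by apply/ffunP => j; apply: IH; apply: eqts; rewrite mem_enum.
Qed.

HB.instance Definition _ ar := Equality.copy (term ar) (inj_type (@code_term_inj ar)).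
HB.instance Definition _ ar := gen_choiceMixin (term ar).

Definition equation (ar : nat -> nat) := (term ar * term ar)%type.

Definition code_equation ar (e : equation ar) : nat :=
  CodeSeq.code [:: code_term e.1; code_term e.2].

(* The canonical index of a finite set of numbers: D = \sum_(n in D) 2 ^ n. *)
Definition code_equations ar (S : {fset equation ar}) : nat :=
  (\sum_(e <- S) 2 ^ code_equation e)%N.

(** * Algebras on a metric space, and lambda *)

Definition operations (ar : nat -> nat) (A : Type) : Type :=
  forall i, ('I_(ar i) -> A) -> A.

Fixpoint term_op ar A (F : operations ar A) (t : term ar) (a : nat -> A) : A :=
  match t with
  | Var k => a k
  | App i ts => F i (fun j => term_op F (ts j) a)
  end.

Definition continuous_operations (R : realType) (A : metricType R)
    (ar : nat -> nat) (F : operations ar A) : Prop :=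
  forall i, continuous (F i : {ptws 'I_(ar i) -> A} -> A).

(* Distances being nonnegative, adjoining 0 only matters for the convention
   that the supremum of the empty set is 0. *)
Definition lambda_algebra (R : realType) (A : metricType R) (ar : nat -> nat)
    (F : operations ar A) (S : set (equation ar)) : \bar R :=
  ereal_sup ([set 0%E] `|`
    [set x | exists2 e, S e &
       exists a : nat -> A, x = (mdist (term_op F e.1 a) (term_op F e.2 a))%:E]).

Definition lambda (R : realType) (A : metricType R) (ar : nat -> nat)
    (S : set (equation ar)) : \bar R :=
  ereal_inf [set lambda_algebra F S | F in @continuous_operations R A ar].

(** * Simplicial complexes *)

Definition simplicial_complex (V : finType) (K : {set {set V}}) : Prop :=
  [/\ finset.set0 \notin K, finset.cover K = [set: V]%SET &
      forall s t : {set V}, s \in K -> t \subset s -> t != finset.set0 -> t \in K].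

Definition in_realization (R : realType) (V : finType) (K : {set {set V}})
    (b : {ffun V -> R}) : bool :=
  [&& [forall v, 0 <= b v <= 1], \sum_v b v == 1 &
      [set v | 0 < b v]%SET \in K].

Definition realization (R : realType) (V : finType) (K : {set {set V}}) : Type :=
  {b : {ffun V -> R} | in_realization K b}.

Section EuclideanMetric.
Context (R : realType) (V : finType) (K : {set {set V}}).

HB.instance Definition _ := Choice.on (realization R K).

Definition euclidean_dist (b c : realization R K) : R :=
  Num.sqrt (\sum_v (val b v - val c v) ^+ 2).

Let sqr_sum_ge0 (a : V -> R) : 0 <= \sum_v a v ^+ 2.
Proof. by apply: sumr_ge0 => v _; exact: sqr_ge0. Qed.

Let cauchy_schwarz (a b : V -> R) :
  (\sum_v a v * b v) ^+ 2 <= (\sum_v a v ^+ 2) * (\sum_v b v ^+ 2).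
Proof.
set p := \sum_v a v * b v; set A := \sum_v a v ^+ 2; set B := \sum_v b v ^+ 2.
have : 0 <= \sum_v (B * a v - p * b v) ^+ 2 by exact: sqr_sum_ge0.
have -> : \sum_v (B * a v - p * b v) ^+ 2 = B * (A * B - p ^+ 2).
  have sqE v : (B * a v - p * b v) ^+ 2 =
      B ^+ 2 * a v ^+ 2 - 2 * B * p * (a v * b v) + p ^+ 2 * b v ^+ 2 by ring.
  rewrite (eq_bigr _ (fun v _ => sqE v)) big_split sumrB /= -!mulr_sumr.
  by rewrite -/A -/B -/p; ring.
have := sqr_sum_ge0 b; rewrite -/B le_eqVlt => /predU1P[B0 _|B_gt0].
  have b0 v : b v = 0.
    apply/eqP; rewrite -sqrf_eq0; apply/eqP.
    by apply: (psumr_eq0P (P := xpredT) _ (esym B0)) => // w _; exact: sqr_ge0.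
  by rewrite -B0 mulr0 /p big1 ?expr0n // => v _; rewrite b0 mulr0.
by rewrite pmulr_rge0 // subr_ge0.
Qed.

Let euclidean_distxx b : euclidean_dist b b = 0.
Proof. by rewrite /euclidean_dist big1 ?sqrtr0 // => v _; rewrite subrr expr0n. Qed.

Let euclidean_dist_eq0 b c : euclidean_dist b c = 0 -> b = c.
Proof.
move/eqP; rewrite sqrtr_eq0 => d_le0; apply/val_inj/ffunP => v.
have d0 : \sum_v (val b v - val c v) ^+ 2 = 0.
  by apply/eqP; rewrite eq_le d_le0 sqr_sum_ge0.
apply/eqP; rewrite -subr_eq0 -sqrf_eq0; apply/eqP.
by apply: (psumr_eq0P (P := xpredT) _ d0) => // w _; exact: sqr_ge0.
Qed.

Let euclidean_distC b c : euclidean_dist b c = euclidean_dist c b.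
Proof.
by congr Num.sqrt; apply: eq_bigr => v _; rewrite -[RHS]sqrrN opprB.
Qed.

Let euclidean_dist_triangle c b d :
  euclidean_dist b d <= euclidean_dist b c + euclidean_dist c d.
Proof.
rewrite /euclidean_dist; set f := fun v => val b v - val c v.
set g := fun v => val c v - val d v.
set A := \sum_v f v ^+ 2; set B := \sum_v g v ^+ 2.
have A0 : 0 <= A by exact: sqr_sum_ge0.
have B0 : 0 <= B by exact: sqr_sum_ge0.
rewrite -[leRHS]ger0_norm ?addr_ge0 ?sqrtr_ge0 // -sqrtr_sqr ler_wsqrtr //.
rewrite sqrrD !sqr_sqrtr //.
have -> : \sum_v (val b v - val d v) ^+ 2 = A + (\sum_v f v * g v) *+ 2 + B.
  rewrite -mulr_natl mulr_sumr /A /B -!big_split /=.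
  by apply: eq_bigr => v _; rewrite /f /g; ring.
rewrite lerD2r lerD2l lerMn2r /= -sqrtrM //.
by rewrite (le_trans (ler_norm _)) // -sqrtr_sqr ler_wsqrtr // cauchy_schwarz.
Qed.

HB.instance Definition _ := isMetric.Build R (realization R K)
  euclidean_distxx euclidean_dist_eq0 euclidean_distC euclidean_dist_triangle.

End EuclideanMetric.

(* Main.v *)
(* A finite certificate for lambda < alpha consists of a mesh N, for each operation
   symbol in use a finite table prescribing values at the points of |K| with
   coordinates in (1/N)Z, and a list of codes of terms closed under subterms.
   Averaging the prescribed values with a partition of unity turns a table into a
   continuous operation, provided that the values prescribed near any given point
   lie in a common simplex.  The equations are tested on all traces, that is, on
   all ways to attach a mesh point to each listed term so that every compound
   term is attached a point that its table allows, up to rounding, for the points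
   attached to its arguments.  Rounding the values of the terms in the averaged
   algebra yields a trace, so a test passed with margin bounds lambda.
   Conversely, continuous operations with lambda < alpha are uniformly continuous
   because |K| is compact; tabulating them on a fine mesh gives a certificate,
   since by induction on terms all traces are then close to true evaluations.
   Before tabulating, coordinates at most eps are put to 0: values that are close
   to each other then have supports inside one simplex. *)
Require Import Defs.
From mathcomp Require Import all_boot all_order all_algebra finmap.
From mathcomp Require Import all_classical all_reals all_analysis.
From mathcomp Require Import zify ring lra.

Set Implicit Arguments.
Unset Strict Implicit.
Unset Printing Implicit Defensive.

Import Order.TTheory GRing.Theory Num.Theory.
Import numFieldNormedType.Exports.

Local Open Scope classical_set_scope.

(** * Recursive functions of several variables *)

Local Open Scope nat_scope.

Lemma recursive_comp1 k (h : nat -> nat) (f : k.-tuple nat -> nat) :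
  recursive1 h -> recursive f -> recursive (fun x => h (f x)).
Proof.
move=> rh rf; apply: recursive_ext (recursive_comp rh (fun _ : 'I_1 => rf)) => x.
by rewrite /thead tnth_mktuple.
Qed.

Lemma tnth_behead_lift (T : Type) k (x : k.+1.-tuple T) (i : 'I_k) :
  tnth (behead_tuple x : k.-tuple T) i = tnth x (lift ord0 i).
Proof.
have x0 := thead x; rewrite !(tnth_nth x0) /= nth_behead.
by rewrite /bump.
Qed.

Lemma recursive_behead k (f : k.-tuple nat -> nat) :
  recursive f -> recursive (fun x : k.+1.-tuple nat => f (behead_tuple x)).
Proof.
move=> rf.
apply: recursive_ext (recursive_comp rf (fun i => recursive_proj (lift ord0 i))) => x.
by apply: (congr1 f); apply: eq_from_tnth => i; rewrite tnth_mktuple tnth_behead_lift.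
Qed.

Lemma recursive_thead k : recursive (fun x : k.+1.-tuple nat => thead x).
Proof. exact: recursive_proj. Qed.

Lemma recursive_const k n : recursive (fun _ : k.-tuple nat => n).
Proof.
elim: n => [|n IHn].
  by apply: recursive_ext (recursive_comp recursive_zero
    (fun i : 'I_0 => recursive_proj (widen_ord (leq0n k) i))).
exact: recursive_comp1 recursive_succ IHn.
Qed.

(** [recursive_primrec] recurses on the first coordinate of its argument; feeding it the tuple
    [n x :: x] turns it into recursion up to a computed bound, with [x] as parameter. *)
Lemma recursive_nat_rect k (z n : k.-tuple nat -> nat)
    (s : nat -> nat -> k.-tuple nat -> nat) :
  recursive z ->
  recursive (fun x : k.+2.-tuple nat =>
    s (thead x) (thead (behead_tuple x)) (behead_tuple (behead_tuple x))) ->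
  recursive n ->
  recursive (fun x => nat_rect (fun=> nat) (z x) (fun m r => s m r x) (n x)).
Proof.
move=> rz rs rn.
pose g (i : 'I_k.+1) (x : k.-tuple nat) :=
  if unlift ord0 i is Some j then tnth x j else n x.
have rg i : recursive (g i).
  by rewrite /g; case: (unlift ord0 i) => [j|//]; exact: recursive_proj.
apply: recursive_ext (recursive_comp (recursive_primrec rz rs) rg) => x.
have -> : behead_tuple [tuple g i x | i < k.+1] = x :> k.-tuple nat.
  by apply: eq_from_tnth => i; rewrite tnth_behead_lift tnth_mktuple /g liftK.
have -> : thead [tuple g i x | i < k.+1] = n x.
  by rewrite /thead tnth_mktuple /g unlift_none.
elim: (n x) => //= m ->; congr (s _ _ _).
by apply: val_inj.
Qed.

Lemma recursive_add k (f g : k.-tuple nat -> nat) :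
  recursive f -> recursive g -> recursive (fun x => f x + g x).
Proof.
move=> rf rg; have := @recursive_nat_rect k f g (fun _ r _ => r.+1) rf
  (recursive_comp1 recursive_succ (recursive_behead (recursive_thead _))) rg.
apply: recursive_ext => x; elim: (g x) => [|n /= ->]; by rewrite ?addn0 ?addnS.
Qed.

Lemma recursive_mul k (f g : k.-tuple nat -> nat) :
  recursive f -> recursive g -> recursive (fun x => f x * g x).
Proof.
move=> rf rg; have := @recursive_nat_rect k _ g (fun _ r x => r + f x) (recursive_const k 0)
  (recursive_add (recursive_behead (recursive_thead _))
     (recursive_behead (recursive_behead rf))) rg.
by apply: recursive_ext => x; elim: (g x) => [|n /= ->]; rewrite ?muln0 // mulnS addnC.
Qed.

Lemma recursive_pred k (f : k.-tuple nat -> nat) :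
  recursive f -> recursive (fun x => (f x).-1).
Proof.
move=> rf; have := @recursive_nat_rect k _ f (fun n _ _ => n) (recursive_const k 0)
  (recursive_thead _) rf.
by apply: recursive_ext => x; case: (f x).
Qed.

Lemma recursive_sub k (f g : k.-tuple nat -> nat) :
  recursive f -> recursive g -> recursive (fun x => f x - g x).
Proof.
move=> rf rg; have := @recursive_nat_rect k f g (fun _ r _ => r.-1) rf
  (recursive_pred (recursive_behead (recursive_thead _))) rg.
apply: recursive_ext => x; elim: (g x) => [|n /= ->]; by rewrite ?subn0 ?subnS.
Qed.

Lemma recursive_exp2 k (f : k.-tuple nat -> nat) :
  recursive f -> recursive (fun x => 2 ^ f x).
Proof.
move=> rf; have := @recursive_nat_rect k _ f (fun _ r _ => r + r) (recursive_const k 1)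
  (recursive_add (recursive_behead (recursive_thead _))
     (recursive_behead (recursive_thead _))) rf.
by apply: recursive_ext => x; elim: (f x) => [|n /= ->] //; rewrite expnS mul2n addnn.
Qed.

Lemma recursive_cond k (f g : k.-tuple nat -> nat) (b : k.-tuple nat -> bool) :
  recursive (fun x => b x : nat) -> recursive f -> recursive g ->
  recursive (fun x => if b x then f x else g x).
Proof.
move=> rb rf rg; have := recursive_add (recursive_mul rb rf)
  (recursive_mul (recursive_sub (recursive_const k 1) rb) rg).
apply: recursive_ext => x; case: (b x); rewrite ?mul1n ?mul0n //.
by rewrite addn0.
Qed.

Lemma recursive_odd k (f : k.-tuple nat -> nat) :
  recursive f -> recursive (fun x => odd (f x) : nat).
Proof.
move=> rf; have := @recursive_nat_rect k _ f (fun _ r _ => 1 - r) (recursive_const k 0)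
  (recursive_sub (recursive_const _ 1) (recursive_behead (recursive_thead _))) rf.
by apply: recursive_ext => x; elim: (f x) => [|n /= ->] //=; case: (odd n).
Qed.

Lemma recursive_half k (f : k.-tuple nat -> nat) :
  recursive f -> recursive (fun x => (f x)./2).
Proof.
move=> rf; have := @recursive_nat_rect k _ f (fun n r _ => r + odd n) (recursive_const k 0)
  (recursive_add (recursive_behead (recursive_thead _)) (recursive_odd (recursive_thead _))) rf.
apply: recursive_ext => x; elim: (f x) => [|n IH] //.
by rewrite [LHS]/= IH -[in LHS]/(n./2) /= uphalf_half addnC.
Qed.

Lemma recursive_iter_half k (f g : k.-tuple nat -> nat) :
  recursive f -> recursive g -> recursive (fun x => iter (g x) half (f x)).
Proof.
move=> rf rg; have := @recursive_nat_rect k f g (fun _ r _ => r./2) rf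
  (recursive_half (recursive_behead (recursive_thead _))) rg.
by apply: recursive_ext => x; elim: (g x) => //= n ->.
Qed.

(** One step of [CodeSeq.code]: the code of [n :: s] is convertible to [cons_code n] applied to the
    code of [s], and the empty list has code 0. *)
Definition cons_code n m := 2 ^ n * m.*2.+1.

(* The 2-adic valuation of c (0 if c = 0). *)
Definition head_code c :=
  nat_rect (fun=> nat) 0 (fun _ r => if odd (iter r half c) then r else r.+1) c.

Definition behead_code c := (iter (head_code c) half c)./2.

Lemma iter_half_cons n m r : r <= n ->
  iter r half (cons_code n m) = cons_code (n - r) m.
Proof.
elim: r => [|r IHr] lt_rn; first by rewrite subn0.
rewrite /= IHr 1?ltnW // /cons_code -(subnSK lt_rn) expnS -mulnA mul2n.
by rewrite doubleK.
Qed.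

Lemma head_codeK n m : head_code (cons_code n m) = n.
Proof.
rewrite /head_code; set c := cons_code n m.
(* The number of iterations is [c] itself, which suffices because [n < 2 ^ n <= c]. *)
have le_nc : n <= c.
  by rewrite (leq_trans (ltnW (ltn_expl n (isT : 1 < 2)))) // leq_pmulr.
(* The counter climbs until it meets the lowest bit 1 of [c], at position [n], and then stays
   there. *)
suff H j : nat_rect (fun=> nat) 0
    (fun _ r => if odd (iter r half c) then r else r.+1) j = minn j n.
  by rewrite H; apply/minn_idPr.
elim: j => [|j /= ->]; first by rewrite min0n.
rewrite iter_half_cons ?geq_minr // /cons_code oddM oddS odd_double andbT.
rewrite oddX /= orbF; case: eqP; lia.
Qed.

Lemma behead_codeK n m : behead_code (cons_code n m) = m.
Proof.
rewrite /behead_code head_codeK iter_half_cons // subnn /cons_code mul1n /=.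
by rewrite uphalf_double.
Qed.

Lemma recursive_cons_code k (f g : k.-tuple nat -> nat) :
  recursive f -> recursive g -> recursive (fun x => cons_code (f x) (g x)).
Proof.
move=> rf rg; have := recursive_mul (recursive_exp2 rf)
  (recursive_comp1 recursive_succ (recursive_add rg rg)).
by apply: recursive_ext => x; rewrite addnn.
Qed.

Lemma recursive_head_code : recursive1 head_code.
Proof.
apply: (@recursive_nat_rect 1 (fun=> 0) (fun x => thead x)
  (fun _ r x => if odd (iter r half (thead x)) then r else r.+1)).
- exact: recursive_const.
- have rr := recursive_behead (recursive_thead 1).
  apply: recursive_cond => //; last exact: (recursive_comp1 (h := succn) recursive_succ rr).
  apply/recursive_odd/recursive_iter_half => //.
  exact: (recursive_behead (recursive_behead (recursive_thead 0))).
- exact: recursive_thead.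
Qed.

Lemma recursive_behead_code : recursive1 behead_code.
Proof.
apply/recursive_half/recursive_iter_half; first exact: recursive_thead.
exact: recursive_head_code.
Qed.

(** * Computable functions between encoded types *)

Class coded (T : Type) := { enc : T -> nat; enc_inj : injective enc }.

#[local] Instance coded_nat : coded nat := {| enc := id; enc_inj := @inj_id nat |}.

Lemma nat_of_bool_inj : injective nat_of_bool.
Proof. by case; case. Qed.

#[local] Instance coded_bool : coded bool :=
  {| enc := nat_of_bool; enc_inj := nat_of_bool_inj |}.

Lemma enc_pair_inj T U (cT : coded T) (cU : coded U) :
  injective (fun p : T * U => CodeSeq.code [:: enc p.1; enc p.2]).
Proof. by move=> [a b] [c d] /(can_inj CodeSeq.codeK)[ac bd]; congr (_, _); exact: enc_inj. Qed.

#[local] Instance coded_pair T U (cT : coded T) (cU : coded U) : coded (T * U) :=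
  {| enc := _; enc_inj := @enc_pair_inj T U cT cU |}.

Lemma enc_seq_inj T (cT : coded T) :
  injective (fun s : seq T => CodeSeq.code [seq enc a | a <- s]).
Proof.
by move=> s t /(can_inj CodeSeq.codeK)/(inj_map (@enc_inj T cT)).
Qed.

#[local] Instance coded_seq T (cT : coded T) : coded (seq T) :=
  {| enc := _; enc_inj := @enc_seq_inj T cT |}.

(** Realizability on codes: [g] is unconstrained at numbers that code nothing, so codes need not
    form a recursive set. *)
Definition computable A B {cA : coded A} {cB : coded B} (f : A -> B) : Prop :=
  exists2 g, recursive1 g & forall a, enc (f a) = g (enc a).

Definition pair_code a b := cons_code a (cons_code b 0).

Lemma recursive_pair_code k (f g : k.-tuple nat -> nat) :
  recursive f -> recursive g -> recursive (fun x => pair_code (f x) (g x)).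
Proof.
by move=> *; exact/recursive_cons_code/recursive_cons_code/recursive_const.
Qed.

Lemma enc_cons A (cA : coded A) (a : A) (s : seq A) :
  enc (a :: s) = cons_code (enc a) (enc s).
Proof. by []. Qed.

(** * Closure under composition, pairing, recursion and case distinction *)

Section Closure.
Context {G A B : Type} {cG : coded G} {cA : coded A} {cB : coded B}.

Lemma computable_ext (f g : G -> A) : f =1 g -> computable f -> computable g.
Proof. by move=> fg [h rh hE]; exists h => // a; rewrite -fg. Qed.

Lemma computable_id : computable (fun x : G => x).
Proof. by exists id => //; exact: recursive_thead. Qed.

Lemma computable_const (a : A) : computable (fun _ : G => a).
Proof. by exists (fun=> enc a) => //; exact: recursive_const. Qed.

Lemma computable_comp (f : G -> A) (g : A -> B) :
  computable g -> computable f -> computable (fun x => g (f x)).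
Proof.
move=> [g' rg gE] [f' rf fE]; exists (fun c => g' (f' c)).
  exact: recursive_comp1 rg rf.
by move=> a; rewrite gE fE.
Qed.

Lemma computable_pair (f : G -> A) (g : G -> B) :
  computable f -> computable g -> computable (fun x => (f x, g x)).
Proof.
move=> [f' rf fE] [g' rg gE].
exists (fun c => pair_code (f' c) (g' c)).
  exact: recursive_pair_code.
by move=> a; rewrite -fE -gE.
Qed.

Lemma computable_fst (f : G -> A * B) :
  computable f -> computable (fun x => (f x).1).
Proof.
move=> [f' rf fE]; exists (fun c => head_code (f' c)).
  exact: recursive_comp1 recursive_head_code rf.
by move=> a; rewrite -fE; exact/esym/head_codeK.
Qed.

Lemma computable_snd (f : G -> A * B) :
  computable f -> computable (fun x => (f x).2).
Proof.
move=> [f' rf fE]; exists (fun c => head_code (behead_code (f' c))).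
  exact: recursive_comp1 recursive_head_code (recursive_comp1 recursive_behead_code rf).
move=> a; rewrite -fE /= [X in behead_code X]/(cons_code _ _) behead_codeK.
by rewrite -[RHS]/(head_code (cons_code _ _)) head_codeK.
Qed.

Lemma computable_nat_rect (z : G -> A) (s : G -> nat -> A -> A) (n : G -> nat) :
  computable z -> computable (fun p : G * nat * A => s p.1.1 p.1.2 p.2) ->
  computable n ->
  computable (fun x => nat_rect (fun=> A) (z x) (fun m r => s x m r) (n x)).
Proof.
move=> [z' rz zE] [s' rs sE] [n' rn nE].
exists (fun c => nat_rect (fun=> nat) (z' c) (fun m r => s' (pair_code (pair_code c m) r)) (n' c)).
  apply: (@recursive_nat_rect 1 _ _ (fun m r x => s' (pair_code (pair_code (thead x) m) r))) => //.
  apply: (recursive_comp1 rs); apply: recursive_pair_code; last exact/recursive_behead/recursive_thead.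
  apply: recursive_pair_code; last exact: recursive_thead.
  exact: (recursive_behead (recursive_behead (recursive_thead 0))).
move=> a; rewrite -nE; elim: (n a) => [|m IHm] /=; first exact: zE.
by rewrite -IHm (sE (a, m, _)).
Qed.

Lemma computable_if (b : G -> bool) (f g : G -> A) :
  computable b -> computable f -> computable g ->
  computable (fun x => if b x then f x else g x).
Proof.
move=> [b' rb bE] [f' rf fE] [g' rg gE].
exists (fun c => if 0 < b' c then f' c else g' c).
  apply: (recursive_cond (b := fun x => 0 < b' (thead x))) => //.
  (* [1 - (1 - b')] is the sign of [b'], which may exceed 1 at numbers that are not codes. *)
  have := recursive_sub (recursive_const 1 1) (recursive_sub (recursive_const 1 1) rb).
  by apply: recursive_ext => x; case: (b' _).
by move=> a; rewrite -bE; case: (b a) => /=; rewrite ?fE ?gE.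
Qed.

Lemma computable_cons (f : G -> A) (s : G -> seq A) :
  computable f -> computable s -> computable (fun x => f x :: s x).
Proof.
move=> [f' rf fE] [s' rs sE]; exists (fun c => cons_code (f' c) (s' c)).
  exact: recursive_cons_code.
by move=> a; rewrite -fE -sE.
Qed.

(** The empty list is the only one with code 0, so positivity of the code decides the case. *)
Lemma computable_seq_case (s : G -> seq A) (f : G -> A -> seq A -> B) (g : G -> B) :
  computable s -> computable (fun p : G * A * seq A => f p.1.1 p.1.2 p.2) ->
  computable g ->
  computable (fun x => if s x is a :: r then f x a r else g x).
Proof.
move=> [s' rs sE] [f' rf fE] [g' rg gE].
exists (fun c => if 0 < s' c then f' (pair_code (pair_code c (head_code (s' c))) (behead_code (s' c)))
                 else g' c).
  apply: (recursive_cond (b := fun x => 0 < s' (thead x))) => //.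
    have := recursive_sub (recursive_const 1 1) (recursive_sub (recursive_const 1 1) rs).
    by apply: recursive_ext => x; case: (s' _).
  apply: (recursive_comp1 rf); apply: recursive_pair_code; last exact: recursive_comp1 recursive_behead_code rs.
  apply: recursive_pair_code; last exact: recursive_comp1 recursive_head_code rs.
  exact: recursive_thead.
move=> a; rewrite -sE; case: (s a) => [|b r]; first exact: gE.
rewrite enc_cons ifT; last by rewrite /cons_code muln_gt0 expn_gt0.
by rewrite head_codeK behead_codeK (fE (a, b, r)).
Qed.

Lemma computable_enc (f : G -> A) : computable f -> computable (fun x => enc (f x)).
Proof. by case=> f' rf fE; exists f'. Qed.

End Closure.

(** * Arithmetic, Boolean operations and equality *)

Section Arithmetic.
Context {G : Type} {cG : coded G}.
Implicit Types (f g : G -> nat).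

Lemma computable_recursive1 h f :
  recursive1 h -> computable f -> computable (fun x => h (f x)).
Proof. by move=> rh; apply: computable_comp; exists h. Qed.

Lemma computable_succ f : computable f -> computable (fun x => (f x).+1).
Proof. by apply: computable_recursive1; exact: recursive_succ. Qed.

Lemma computable_add f g :
  computable f -> computable g -> computable (fun x => f x + g x).
Proof.
move=> [f' rf fE] [g' rg gE]; exists (fun c => f' c + g' c).
  exact: recursive_add.
by move=> a; rewrite -fE -gE.
Qed.

Lemma computable_mul f g :
  computable f -> computable g -> computable (fun x => f x * g x).
Proof.
move=> [f' rf fE] [g' rg gE]; exists (fun c => f' c * g' c).
  exact: recursive_mul.
by move=> a; rewrite -fE -gE.
Qed.

Lemma computable_sub f g :
  computable f -> computable g -> computable (fun x => f x - g x).
Proof.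
move=> [f' rf fE] [g' rg gE]; exists (fun c => f' c - g' c).
  exact: recursive_sub.
by move=> a; rewrite -fE -gE.
Qed.

Lemma computable_exp2 f : computable f -> computable (fun x => 2 ^ f x).
Proof.
apply: (computable_recursive1 (h := expn 2)).
exact/recursive_exp2/recursive_thead.
Qed.

Lemma computable_leq f g :
  computable f -> computable g -> computable (fun x => f x <= g x).
Proof.
move=> /computable_sub /[apply] -[h rh hE]; exists (fun c => 1 - h c).
  exact: recursive_sub (recursive_const _ _) rh.
by move=> a; rewrite -hE /= /leq; case: (_ - _).
Qed.

Lemma computable_andb (b c : G -> bool) :
  computable b -> computable c -> computable (fun x => b x && c x).
Proof. by move=> cb cc; apply: computable_if cb cc (computable_const _). Qed.

Lemma computable_implyb (b c : G -> bool) :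
  computable b -> computable c -> computable (fun x => b x ==> c x).
Proof. by move=> cb cc; apply: computable_if cb cc (computable_const _). Qed.

Lemma computable_orb (b c : G -> bool) :
  computable b -> computable c -> computable (fun x => b x || c x).
Proof. by move=> cb cc; exact: computable_if cb (computable_const _) cc. Qed.

Lemma computable_negb (b : G -> bool) :
  computable b -> computable (fun x => ~~ b x).
Proof. by move=> cb; apply: computable_if cb (computable_const _) (computable_const _). Qed.

(** By injectivity of [enc], comparing the codes is enough. *)
Lemma computable_eq (T : eqType) (cT : coded T) (f g : G -> T) :
  computable f -> computable g -> computable (fun x => f x == g x).
Proof.
move=> /computable_enc cf /computable_enc cg.
have := computable_andb (computable_leq cf cg) (computable_leq cg cf).
by apply: computable_ext => x; rewrite -eqn_leq (inj_eq (@enc_inj T cT)).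
Qed.

(** Every number is the code of the list it decodes to, so on codes decoding is the identity. *)
Lemma computable_decode f : computable f -> computable (fun x => CodeSeq.decode (f x)).
Proof.
case=> f' rf fE; exists f' => // a.
by rewrite /= map_id CodeSeq.decodeK; exact: fE.
Qed.

End Arithmetic.

(** * Functions on finite lists *)

Section Sequences.
Context {G A B : Type} {cG : coded G} {cA : coded A} {cB : coded B}.

(** Supplies a computable bound on the number of steps needed to traverse a list. *)
Lemma size_leq_enc (s : seq A) : size s <= enc s.
Proof.
elim: s => // a s IHs; rewrite enc_cons /cons_code.
rewrite (leq_trans _ (leq_pmull _ _)) ?expn_gt0 // ltnS (leq_trans IHs) //.
by rewrite -addnn leq_addr.
Qed.

Lemma computable_foldl (f : G -> B -> A -> B) (z : G -> B) (s : G -> seq A) :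
  computable (fun p : G * B * A => f p.1.1 p.1.2 p.2) -> computable z ->
  computable s -> computable (fun x => foldl (fun r a => f x r a) (z x) (s x)).
Proof.
move=> cf cz cs.
(* The state consists of the unread part of the list and the accumulator. It is stationary once the
   list is used up, so extra iterations do no harm. *)
pose step x (p : seq A * B) := if p.1 is a :: r then (r, f x p.2 a) else p.
have step_foldl x n t b : size t <= n ->
    (nat_rect (fun=> _) (t, b) (fun _ p => step x p) n).2 = foldl (f x) b t.
  have -> : nat_rect (fun=> _) (t, b) (fun _ p => step x p) n = iter n (step x) (t, b).
    by elim: n => //= n ->.
  by elim: n t b => [|n IHn] [|a t] b //; rewrite iterSr => le_tn; rewrite IHn.
have cstep : computable (fun x => nat_rect (fun=> _) (s x, z x) (fun _ p => step x p) (enc (s x))).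
  apply: computable_nat_rect; [exact: computable_pair| |exact: computable_enc].
  rewrite /step; apply: computable_seq_case.
  - exact/computable_fst/computable_snd/computable_id.
  - apply: computable_pair; first exact/computable_snd/computable_id.
    have ch : computable (fun p : G * nat * (seq A * B) * A * seq A =>
       (p.1.1.1.1, p.1.1.2.2, p.1.2)).
      apply: computable_pair; [apply: computable_pair|].
      + do 4 apply: computable_fst; exact: computable_id.
      + apply: computable_snd; apply: computable_snd; do 2 apply: computable_fst.
        exact: computable_id.
      + exact/computable_snd/computable_fst/computable_id.
    exact: computable_comp cf ch.
  - exact/computable_snd/computable_id.
by apply: computable_ext (computable_snd cstep) => x; rewrite step_foldl ?size_leq_enc.
Qed.

End Sequences.

Lemma computable_app3 H G A B C (cH : coded H) (cG : coded G) (cA : coded A)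
    (cB : coded B) (cC : coded C) (f : G -> A -> B -> C) g a b :
  computable (fun p : G * A * B => f p.1.1 p.1.2 p.2) ->
  computable g -> computable a -> computable b ->
  computable (fun x : H => f (g x) (a x) (b x)).
Proof.
move=> cf cg ca cb; have := computable_pair (computable_pair cg ca) cb.
exact: (computable_comp cf).
Qed.

Lemma computable_app2 H G A C (cH : coded H) (cG : coded G) (cA : coded A)
    (cC : coded C) (f : G -> A -> C) g a :
  computable (fun p : G * A => f p.1 p.2) ->
  computable g -> computable a -> computable (fun x : H => f (g x) (a x)).
Proof.
move=> cf cg ca; have := computable_pair cg ca.
exact: (computable_comp cf).
Qed.

Ltac computability :=
  repeat match goal with
  | |- computable (fun x => x) => exact: computable_id
  | |- computable (fun _ => ?c) => exact: computable_const
  | |- computable fst => exact: (computable_fst computable_id)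
  | |- computable snd => exact: (computable_snd computable_id)
  | cf : computable (fun p => ?f p.1.1 p.1.2 p.2) |- computable (fun x => ?f _ _ _) =>
      refine (computable_app3 cf _ _ _)
  | cf : computable (fun p => ?f p.1 p.2) |- computable (fun x => ?f _ _) =>
      refine (computable_app2 cf _ _)
  | cf : computable ?f |- computable (fun x => ?f _) =>
      refine (computable_comp cf _)
  | |- _ => assumption
  | |- computable (fun x => fst _) => refine (computable_fst _)
  | |- computable (fun x => snd _) => refine (computable_snd _)
  | |- computable (fun x => (_, _)) => refine (computable_pair _ _)
  | |- computable (fun x => S _) => refine (computable_succ _)
  | |- computable (fun x => addn _ _) => refine (computable_add _ _)
  | |- computable (fun x => muln _ _) => refine (computable_mul _ _)
  | |- computable (fun x => subn _ _) => refine (computable_sub _ _)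
  | |- computable (fun x => expn 2 _) => refine (computable_exp2 _)
  | |- computable (fun x => leq _ _) => refine (computable_leq _ _)
  | |- computable (fun x => eq_op _ _) => refine (computable_eq _ _)
  | |- computable (fun x => ~~ _) => refine (computable_negb _)
  | |- computable (fun x => CodeSeq.decode _) => refine (computable_decode _)
  | |- computable (fun x => _ :: _) => refine (computable_cons _ _)
  | |- computable (fun x => _ && _) => refine (computable_andb _ _)
  | |- computable (fun x => _ || _) => refine (computable_orb _ _)
  | |- computable (fun x => _ ==> _) => refine (computable_implyb _ _)
  | |- computable (fun x => if _ then _ else _) => refine (computable_if _ _ _)
  | |- computable (fun x => foldl _ _ _) => refine (computable_foldl _ _ _)
  | |- computable (fun x => nat_rect _ _ _ _) => refine (computable_nat_rect _ _ _)
  | |- computable (fun x => match _ with nil => _ | cons _ _ => _ end) =>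
      refine (computable_seq_case _ _ _)
  end.

Section Sequences.
Context {G A B : Type} {cG : coded G} {cA : coded A} {cB : coded B}.

Lemma computable_rev (s : G -> seq A) :
  computable s -> computable (fun x => rev (s x)).
Proof.
move=> cs; have : computable (fun x => foldl (fun r a => a :: r) [::] (s x)).
  by computability.
apply: computable_ext => x; rewrite /rev.
by elim: (s x) [::] => //= a t IHt r; rewrite IHt.
Qed.

Lemma computable_foldr (f : G -> A -> B -> B) (z : G -> B) (s : G -> seq A) :
  computable (fun p : G * A * B => f p.1.1 p.1.2 p.2) -> computable z ->
  computable s -> computable (fun x => foldr (fun a r => f x a r) (z x) (s x)).
Proof.
move=> cf cz /computable_rev cs.
have : computable (fun x => foldl (fun r a => f x a r) (z x) (rev (s x))).
  by computability.
by apply: computable_ext => x; rewrite foldl_rev.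
Qed.

End Sequences.

Section Sequences.
Context {G A B : Type} {cG : coded G} {cA : coded A} {cB : coded B}.

Lemma computable_map (f : G -> A -> B) (s : G -> seq A) :
  computable (fun p : G * A => f p.1 p.2) -> computable s ->
  computable (fun x => [seq f x a | a <- s x]).
Proof.
move=> cf cs; have : computable (fun x => foldr (fun a r => f x a :: r) [::] (s x)).
  by apply: computable_foldr; computability.
by apply: computable_ext => x; elim: (s x) => //= a t ->.
Qed.

End Sequences.

Section Sequences.
Context {G A : Type} {cG : coded G} {cA : coded A}.

Lemma computable_all (f : G -> A -> bool) (s : G -> seq A) :
  computable (fun p : G * A => f p.1 p.2) -> computable s ->
  computable (fun x => all (fun a => f x a) (s x)).
Proof.
move=> cf cs; have : computable (fun x => foldr (fun a r => f x a && r) true (s x)).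
  by apply: computable_foldr; computability.
by apply: computable_ext => x; elim: (s x) => //= a t ->.
Qed.

Lemma computable_has (f : G -> A -> bool) (s : G -> seq A) :
  computable (fun p : G * A => f p.1 p.2) -> computable s ->
  computable (fun x => has (fun a => f x a) (s x)).
Proof.
move=> cf cs; have : computable (fun x => foldr (fun a r => f x a || r) false (s x)).
  by apply: computable_foldr; computability.
by apply: computable_ext => x; elim: (s x) => //= a t ->.
Qed.

Lemma computable_filter (f : G -> A -> bool) (s : G -> seq A) :
  computable (fun p : G * A => f p.1 p.2) -> computable s ->
  computable (fun x => [seq a <- s x | f x a]).
Proof.
move=> cf cs.
have : computable (fun x => foldr (fun a r => if f x a then a :: r else r) [::] (s x)).
  by apply: computable_foldr; computability.
by apply: computable_ext => x; elim: (s x) => //= a t ->.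
Qed.

Lemma computable_cat (s t : G -> seq A) :
  computable s -> computable t -> computable (fun x => s x ++ t x).
Proof.
move=> cs ct; have : computable (fun x => foldr cons (t x) (s x)).
  by apply: (computable_foldr (f := fun x => cons)); computability.
by apply: computable_ext => x; elim: (s x) => //= a u ->.
Qed.

Lemma computable_size (s : G -> seq A) :
  computable s -> computable (fun x => size (s x)).
Proof.
move=> cs; have : computable (fun x => foldr (fun _ r => r.+1) 0 (s x)).
  by apply: (computable_foldr (f := fun _ _ r => r.+1)); computability.
by apply: computable_ext => x; elim: (s x) => //= a u ->.
Qed.

Lemma computable_behead (s : G -> seq A) :
  computable s -> computable (fun x => behead (s x)).
Proof.
move=> cs; have : computable (fun x => if s x is a :: r then r else [::]).
  by computability.
by apply: computable_ext => x; case: (s x).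
Qed.

Lemma computable_head (z : A) (s : G -> seq A) :
  computable s -> computable (fun x => head z (s x)).
Proof.
move=> cs; have : computable (fun x => if s x is a :: r then a else z).
  by computability.
by apply: computable_ext => x; case: (s x).
Qed.

End Sequences.

Section Sequences.
Context {G A : Type} {cG : coded G} {cA : coded A}.

Lemma computable_nth (z : A) (s : G -> seq A) (n : G -> nat) :
  computable s -> computable n -> computable (fun x => nth z (s x) (n x)).
Proof.
move=> cs cn; have : computable (fun x =>
    head z (nat_rect (fun=> seq A) (s x) (fun _ r => behead r) (n x))).
  apply: computable_head; apply: computable_nat_rect => //.
  by apply: computable_behead; computability.
apply: computable_ext => x; rewrite -nth0 -[n x in RHS]addn0.
by elim: (n x) 0 => //= j IHj i; rewrite nth_behead IHj addnS.
Qed.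

Lemma computable_flatten (s : G -> seq (seq A)) :
  computable s -> computable (fun x => flatten (s x)).
Proof.
move=> cs; apply: (computable_foldr (f := fun x => cat)) => //; last exact: computable_const.
by apply: computable_cat; computability.
Qed.

Lemma computable_sumn (s : G -> seq nat) :
  computable s -> computable (fun x => sumn (s x)).
Proof.
move=> cs; apply: (computable_foldr (f := fun x => addn)) => //; last exact: computable_const.
by computability.
Qed.

Lemma computable_iota (m n : G -> nat) :
  computable m -> computable n -> computable (fun x => iota (m x) (n x)).
Proof.
move=> cm cn; have : computable (fun x =>
    nat_rect (fun=> seq nat) [::] (fun i r => r ++ [:: m x + i]) (n x)).
  by apply: computable_nat_rect => //; [|apply: computable_cat]; computability.
apply: computable_ext => x; elim: (n x) => //= j ->.
by rewrite -[in LHS]/(iota (m x + j) 1) -iotaD addn1.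
Qed.

End Sequences.

Section EqSequences.
Context {G : Type} {A : eqType} {cG : coded G} {cA : coded A}.

Lemma computable_mem (a : G -> A) (s : G -> seq A) :
  computable a -> computable s -> computable (fun x => a x \in s x).
Proof.
move=> ca cs; have : computable (fun x => has (fun b => b == a x) (s x)).
  by apply: computable_has; computability.
by apply: computable_ext => x; rewrite has_pred1.
Qed.

Lemma computable_index (a : G -> A) (s : G -> seq A) :
  computable a -> computable s -> computable (fun x => index (a x) (s x)).
Proof.
move=> ca cs; have : computable (fun x =>
    foldr (fun b r => if b == a x then 0 else r.+1) 0 (s x)).
  by apply: computable_foldr; computability.
by apply: computable_ext => x; elim: (s x) => //= b t ->.
Qed.

End EqSequences.

(** The fold carries the part of the list already read next to the verdict, because the test at an
    element refers to that part. *)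
Lemma computable_uniq (G : Type) (A : eqType) (cG : coded G) (cA : coded A) (s : G -> seq A) :
  computable s -> computable (fun x => uniq (s x)).
Proof.
move=> cs; have : computable (fun x =>
    foldr (fun a p => (p.1 && (a \notin p.2), a :: p.2)) (true, [::]) (s x)).
  by apply: computable_foldr; computability; apply: computable_mem; computability.
move=> /computable_fst; apply: computable_ext => x.
suff -> : foldr (fun a p => (p.1 && (a \notin p.2), a :: p.2)) (true, [::]) (s x) =
    (uniq (s x), s x) by [].
by elim: (s x) => //= a t ->; rewrite andbC.
Qed.

(** * Certificates *)

Lemma computable_pred (G : Type) (cG : coded G) (f : G -> nat) :
  computable f -> computable (fun x => (f x).-1).
Proof.
by apply: (computable_recursive1 (h := predn)); exact/recursive_pred/recursive_thead.
Qed.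

Ltac seq_computability :=
  repeat first [progress computability |
  match goal with
  | |- computable (fun x => predn _) => refine (computable_pred _)
  | |- computable (fun x => map _ _) => refine (computable_map _ _)
  | |- computable (fun x => all _ _) => refine (computable_all _ _)
  | |- computable (fun x => has _ _) => refine (computable_has _ _)
  | |- computable (fun x => seq.filter _ _) => refine (computable_filter _ _)
  | |- computable (fun x => _ ++ _) => refine (computable_cat _ _)
  | |- computable (fun x => size _) => refine (computable_size _)
  | |- computable (fun x => behead _) => refine (computable_behead _)
  | |- computable (fun x => head _ _) => refine (computable_head _ _)
  | |- computable (fun x => nth _ _ _) => refine (computable_nth _ _ _)
  | |- computable (fun x => flatten _) => refine (computable_flatten _)
  | |- computable (fun x => sumn _) => refine (computable_sumn _)
  | |- computable (fun x => iota _ _) => refine (computable_iota _ _)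
  | |- computable (fun x => index _ _) => refine (computable_index _ _)
  | |- computable (fun x => uniq _) => refine (computable_uniq _)
  | |- computable (fun x => in_mem _ _) => refine (computable_mem _ _)
  end].

Definition lists T n (D : seq T) : seq (seq T) :=
  nat_rect (fun=> seq (seq T)) [:: [::]]
    (fun _ r => flatten [seq [seq x :: l | l <- r] | x <- D]) n.

Lemma mem_lists (T : eqType) n (D : seq T) l :
  (l \in lists n D) = (size l == n) && all (fun x => x \in D) l.
Proof.
elim: n l => [|n IHn] [|x l] //=.
  by apply/negbTE/flatten_mapP => -[y _ /mapP[]].
rewrite eqSS andbCA -IHn; apply/flatten_mapP/andP => [[y yD /mapP[l' ll']]|[xD ll]].
  by case=> -> ->.
by exists x => //; exact: map_f.
Qed.

Lemma computable_lists (G A : Type) (cG : coded G) (cA : coded A)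
    (n : G -> nat) (D : G -> seq A) :
  computable n -> computable D -> computable (fun x => lists (n x) (D x)).
Proof.
by move=> cn cD; apply: computable_nat_rect; seq_computability.
Qed.

(** * The decidable test, for [k] vertices and the list [KL] of faces *)

Section Checker.
Variables (ar : nat -> nat) (k : nat) (KL : seq (seq nat)).

Definition supported (s c : seq nat) : bool :=
  all (fun w => (w \in s) || (nth 0 c w == 0)) (iota 0 k).

(** A mesh point is stored as its integer numerators over the common denominator [N]. *)
Definition grid (N : nat) : seq (seq nat) :=
  [seq c <- lists k (iota 0 N.+1) | (sumn c == N) && has (fun s => supported s c) KL].

(** Why the tolerance is [2 k]: rounding an argument moves a coordinate by at most [k] mesh units,
    and a table entry has influence only at distance less than [k + 1]. The integer distance between
    the two is below [2 k + 1]. *)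
Definition near_points n (xs ys : seq (seq nat)) : bool :=
  all (fun j => all (fun w =>
     (nth 0 (nth [::] xs j) w <= nth 0 (nth [::] ys j) w + k.*2) &&
     (nth 0 (nth [::] ys j) w <= nth 0 (nth [::] xs j) w + k.*2)) (iota 0 k)) (iota 0 n).

(* An entry y :: xs of a table prescribes the value y at the argument xs. *)
Definition table_ok n (D : seq (seq nat)) (E : seq (seq (seq nat))) : bool :=
  [&& all (fun e => head [::] e \in D) E,
      all (fun xs => has (fun e => behead e == xs) E) (lists n D) &
      all (fun xs => has (fun s => all (fun e =>
        near_points n xs (behead e) ==> supported s (head [::] e)) E) KL) (lists n D)].

(* Whether y may round the value at points that round to xs. *)
Definition fits n (E : seq (seq (seq nat))) (xs : seq (seq nat)) (y : seq nat) : bool :=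
  all (fun w =>
    has (fun e => near_points n xs (behead e) &&
      (nth 0 (head [::] e) w <= nth 0 y w + k)) E &&
    has (fun e => near_points n xs (behead e) &&
      (nth 0 y w <= nth 0 (head [::] e) w + k)) E) (iota 0 k).

Definition lookup (codes : seq nat) (T : seq (seq nat)) (c : nat) : seq nat :=
  nth [::] T (index c codes).

(** [code_term] stores symbol [i] as [i.+1], keeping 0 for variables. *)
Definition code_symbol c := (head 0 (CodeSeq.decode c)).-1.
Definition code_args c := behead (CodeSeq.decode c).
Definition is_var_code c := head 0 (CodeSeq.decode c) == 0.

Definition code_ok (D : seq (seq nat)) (codes : seq nat)
    (tabs : seq (seq (seq (seq nat)))) (c : nat) : bool :=
  if is_var_code c then size (CodeSeq.decode c) == 2 else
  [&& size (CodeSeq.decode c) == (ar (code_symbol c)).+1,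
      all (fun a => a \in codes) (code_args c) &
      table_ok (ar (code_symbol c)) D (nth [::] tabs (code_symbol c))].

Definition trace_ok (codes : seq nat) (tabs : seq (seq (seq (seq nat))))
    (T : seq (seq nat)) (c : nat) : bool :=
  ~~ is_var_code c ==>
  fits (ar (code_symbol c)) (nth [::] tabs (code_symbol c))
    [seq lookup codes T a | a <- code_args c] (lookup codes T c).

(** Subtraction is truncated, so of the two products one vanishes and the other is the square of the
    difference. *)
Definition sqdist (y z : seq nat) : nat :=
  sumn [seq (nth 0 y w - nth 0 z w) * (nth 0 y w - nth 0 z w) +
            (nth 0 z w - nth 0 y w) * (nth 0 z w - nth 0 y w) | w <- iota 0 k].

Definition equation_code_ok (codes : seq nat) (e : nat) : bool :=
  [&& size (CodeSeq.decode e) == 2, nth 0 (CodeSeq.decode e) 0 \in codes &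
      nth 0 (CodeSeq.decode e) 1 \in codes].

Definition close_sides (codes : seq nat) (d : nat) (T : seq (seq nat)) (e : nat) : bool :=
  sqdist (lookup codes T (nth 0 (CodeSeq.decode e) 0))
         (lookup codes T (nth 0 (CodeSeq.decode e) 1)) <= d * d.

(** Distances are measured in mesh units, so [d] stands for [d / N]. With [uniq eqs], the sum of
    powers of 2 makes [u] the canonical index of the set listed by [eqs]. *)
Definition certifies (u N d : nat) (codes eqs : seq nat)
    (tabs : seq (seq (seq (seq nat)))) : bool :=
  [&& 0 < N, uniq eqs, u == sumn [seq 2 ^ e | e <- eqs],
      all (fun e => equation_code_ok codes e) eqs,
      all (fun c => code_ok (grid N) codes tabs c) codes &
      all (fun T => all (fun c => trace_ok codes tabs T c) codes ==>
                    all (fun e => close_sides codes d T e) eqs)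
        (lists (size codes) (grid N))].

Hypothesis ar_recursive : recursive1 ar.

(** * Computability of the test *)

Section Computability.
Context {G : Type} {cG : coded G}.

Lemma computable_supported (s c : G -> seq nat) :
  computable s -> computable c -> computable (fun x => supported (s x) (c x)).
Proof. by move=> cs cc; rewrite /supported; seq_computability. Qed.

Lemma computable_near_points n (xs ys : G -> seq (seq nat)) :
  computable n -> computable xs -> computable ys ->
  computable (fun x => near_points (n x) (xs x) (ys x)).
Proof. by move=> cn cs cc; rewrite /near_points; seq_computability. Qed.

Lemma computable_sqdist (y z : G -> seq nat) :
  computable y -> computable z -> computable (fun x => sqdist (y x) (z x)).
Proof. by move=> cs cc; rewrite /sqdist; seq_computability. Qed.

Lemma computable_lookup codes T c :
  computable codes -> computable T -> computable c ->
  computable (fun x : G => lookup (codes x) (T x) (c x)).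
Proof. by move=> c1 c2 c3; rewrite /lookup; seq_computability. Qed.

End Computability.

Ltac checker_computability :=
  repeat first [progress seq_computability |
  match goal with
  | |- computable (fun x => lists _ _) => refine (computable_lists _ _)
  | |- computable (fun x => supported _ _) => refine (computable_supported _ _)
  | |- computable (fun x => near_points _ _ _) => refine (computable_near_points _ _ _)
  | |- computable (fun x => sqdist _ _) => refine (computable_sqdist _ _)
  | |- computable (fun x => lookup _ _ _) => refine (computable_lookup _ _ _)
  | |- computable (fun x => ar _) => refine (computable_recursive1 ar_recursive _)
  end].

Section Computability.
Context {G : Type} {cG : coded G}.

Lemma computable_grid (N : G -> nat) :
  computable N -> computable (fun x => grid (N x)).
Proof. move=> cN; rewrite /grid; checker_computability. Qed.

Lemma computable_table_ok n D E :
  computable n -> computable D -> computable E ->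
  computable (fun x : G => table_ok (n x) (D x) (E x)).
Proof. by move=> c1 c2 c3; rewrite /table_ok; checker_computability. Qed.

Lemma computable_fits n E xs y :
  computable n -> computable E -> computable xs -> computable y ->
  computable (fun x : G => fits (n x) (E x) (xs x) (y x)).
Proof. by move=> c1 c2 c3 c4; rewrite /fits; checker_computability. Qed.

Lemma computable_code_ok D codes tabs c :
  computable D -> computable codes -> computable tabs -> computable c ->
  computable (fun x : G => code_ok (D x) (codes x) (tabs x) (c x)).
Proof.
move=> c1 c2 c3 c4; rewrite /code_ok /is_var_code /code_symbol /code_args; checker_computability.
by apply: computable_table_ok; checker_computability.
Qed.

Lemma computable_trace_ok codes tabs T c :
  computable codes -> computable tabs -> computable T -> computable c ->
  computable (fun x : G => trace_ok (codes x) (tabs x) (T x) (c x)).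
Proof.
move=> c1 c2 c3 c4; rewrite /trace_ok /is_var_code /code_symbol /code_args; checker_computability.
by apply: computable_fits; checker_computability.
Qed.

End Computability.

Section Computability.
Context {G : Type} {cG : coded G}.

Lemma computable_certifies u N d codes eqs tabs :
  computable u -> computable N -> computable d -> computable codes ->
  computable eqs -> computable tabs ->
  computable (fun x : G => certifies (u x) (N x) (d x) (codes x) (eqs x) (tabs x)).
Proof.
move=> *; rewrite /certifies /equation_code_ok /close_sides; checker_computability.
- by apply: computable_code_ok; checker_computability; apply: computable_grid; checker_computability.
- by apply: computable_trace_ok; checker_computability.
- by apply: computable_grid; checker_computability.
Qed.

End Computability.

(** * Search through all certificates *)

Section Search.
Variables (p q r : nat -> nat).
Hypotheses (rp : recursive1 p) (rq : recursive1 q) (rr : recursive1 r).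

Definition decode2 c := [seq CodeSeq.decode a | a <- CodeSeq.decode c].
Definition decode3 c := [seq decode2 a | a <- CodeSeq.decode c].
Definition decode4 c := [seq decode3 a | a <- CodeSeq.decode c].

(* a < s (p n - q n) / (r n + 1) - s / 2 ^ n, with denominators cleared. *)
Definition approx_above (a s n : nat) : bool :=
  a * 2 ^ n * (r n).+1 + s * 2 ^ n * q n + s * (r n).+1 < s * 2 ^ n * p n.

(** [m] codes a list [N, d, n, codes, eqs, tabs]. The term [2 * k * k] pays for rounding both sides
    of an equation, each rounding costing at most [k * k] mesh units. *)
Definition check_number (u m : nat) : bool :=
  let c := CodeSeq.decode m in
  approx_above (nth 0 c 1 + 2 * k * k) (nth 0 c 0) (nth 0 c 2) &&
  certifies u (nth 0 c 0) (nth 0 c 1) (CodeSeq.decode (nth 0 c 3))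
    (CodeSeq.decode (nth 0 c 4)) (decode4 (nth 0 c 5)).

Lemma computable_check_number :
  computable (fun x : nat * nat => check_number x.1 x.2).
Proof.
rewrite /check_number /approx_above; apply: computable_andb.
- checker_computability.
  + by apply: (computable_recursive1 rr); checker_computability.
  + by apply: (computable_recursive1 rq); checker_computability.
  + by apply: (computable_recursive1 rr); checker_computability.
  + by apply: (computable_recursive1 rp); checker_computability.
- apply: computable_certifies; rewrite /decode4 /decode3 /decode2; checker_computability.
Qed.

Lemma check_number_surj u N d n codes eqs tabs :
  approx_above (d + 2 * k * k) N n -> certifies u N d codes eqs tabs ->
  exists m, check_number u m.
Proof.
move=> ab ce.
have d2 (t : seq (seq nat)) : decode2 (enc t) = t.
  rewrite /decode2 CodeSeq.codeK -map_comp -[RHS]map_id; apply: eq_map => s /=.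
  by rewrite map_id CodeSeq.codeK.
have d3 t : decode3 (enc t) = t.
  rewrite /decode3 CodeSeq.codeK -map_comp -[RHS]map_id; apply: eq_map => s.
  exact: d2.
have d4 : decode4 (enc tabs) = tabs.
  rewrite /decode4 CodeSeq.codeK -map_comp -[RHS]map_id; apply: eq_map => s.
  exact: d3.
move: (enc tabs) d4 => t d4.
exists (CodeSeq.code [:: N; d; n; CodeSeq.code codes; CodeSeq.code eqs; t]).
by rewrite /check_number CodeSeq.codeK /= ab !CodeSeq.codeK d4.
Qed.

Lemma check_number_re :
  recursively_enumerable [set u | exists m, check_number u m].
Proof.
(* Negated, because [recursively_enumerable] signals success by the value 0. *)
have [g rg gE] := computable_negb computable_check_number.
exists (fun x => g (pair_code (tnth x ord0) (tnth x (lift ord0 ord0)))).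
  apply: (recursive_comp1 rg); apply: recursive_pair_code; exact: recursive_proj.
move=> u; split=> -[m mP]; exists m.
  by rewrite -(gE (u, m)) /= mP.
by apply/negP => /negP nm; move: mP; rewrite -(gE (u, m)) /= nm.
Qed.

End Search.

End Checker.

(** * Mesh points of the realization *)

Local Open Scope ring_scope.

Section Points.
Variables (R : realType) (V : finType) (K : {set {set V}}).
Hypothesis K_complex : simplicial_complex K.
Local Notation k := #|V|.

Definition pcoord (c : seq nat) (v : V) : nat := nth 0%N c (enum_rank v).

(** All faces of [K] are listed, not only the maximal ones. *)
Definition facets : seq (seq nat) :=
  [seq [seq (enum_rank v : nat) | v <- enum s] | s : {set V} <- enum K].

Lemma all_iota_rank (P : pred nat) :
  reflect (forall v : V, P (enum_rank v)) (all P (iota 0 k)).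
Proof.
apply: (iffP allP) => [H v|H w]; first by apply: H; rewrite mem_iota ltn_ord.
rewrite mem_iota /= add0n => lt_w; rewrite -[w]/(nat_of_ord (Ordinal lt_w)).
by rewrite -[Ordinal _]enum_valK.
Qed.

Lemma sum_iota_rank (T : nmodType) (F : nat -> T) :
  \sum_(w <- iota 0 k) F w = \sum_(v : V) F (enum_rank v).
Proof.
rewrite -{1}[k]subn0 -/(index_iota 0 k) big_mkord (reindex (@enum_rank V)) //.
exact/onW_bij/enum_rank_bij.
Qed.

Lemma supportedP (s : {set V}) c :
  reflect (forall v, v \notin s -> pcoord c v = 0%N)
          (supported k [seq (enum_rank v : nat) | v <- enum s] c).
Proof.
have memE v : ((enum_rank v : nat) \in [seq (enum_rank v : nat) | v <- enum s]) = (v \in s).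
  by rewrite (mem_map (inj_comp val_inj enum_rank_inj)) mem_enum.
apply: (iffP (all_iota_rank _)) => H v; have := H v; rewrite memE /pcoord.
  by move=> /[swap] /negbTE -> /eqP.
by case: (v \in s) => //= ->.
Qed.

Lemma mem_facets f : f \in facets ->
  exists2 s, s \in K & f = [seq (enum_rank v : nat) | v <- enum s].
Proof. by case/mapP => s; rewrite mem_enum; exists s. Qed.

Lemma facet_mem s : s \in K -> [seq (enum_rank v : nat) | v <- enum s] \in facets.
Proof. by move=> sK; apply: map_f; rewrite mem_enum. Qed.

Lemma gridP N c :
  reflect [/\ size c = k, (\sum_v pcoord c v)%N = N &
             exists2 s, s \in K & forall v, v \notin s -> pcoord c v = 0%N]
          (c \in grid k facets N).
Proof.
rewrite mem_filter mem_lists.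
have sumE : size c = k -> sumn c = (\sum_v pcoord c v)%N.
  by move=> ck; rewrite -sum_iota_rank sumnE (big_nth 0%N) ck /index_iota subn0.
apply: (iffP idP) => [/andP[/andP[/eqP sc /hasP[f fK fc]] /andP[/eqP ck _]]|].
  have [s sK fE] := mem_facets fK.
  by split; rewrite -?sumE //; exists s => //; apply/supportedP; rewrite -fE.
case=> ck sc [s sK sP]; rewrite sumE // sc eqxx ck eqxx /=; apply/andP; split.
  by apply/hasP; exists [seq (enum_rank v : nat) | v <- enum s]; [exact: facet_mem|exact/supportedP].
apply/(all_nthP 0%N) => i; rewrite ck => lt_i.
suff : nth 0%N c i \in iota 0 N.+1 by [].
rewrite mem_iota /= add0n ltnS.
have {1}-> : i = enum_rank (enum_val (Ordinal lt_i)) by rewrite enum_valK.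
by rewrite -sc (bigD1 (enum_val (Ordinal lt_i))) //= /pcoord enum_valK leq_addr.
Qed.

Definition coords (f : V -> nat) : seq nat := [seq f v | v <- enum V].

Lemma coord_coords f v : pcoord (coords f) v = f v.
Proof.
rewrite /pcoord /coords (nth_map v) ?nth_enum_rank //.
by rewrite -cardE.
Qed.

Lemma size_coords f : size (coords f) = k.
Proof. by rewrite size_map -cardE. Qed.

Lemma mdist_coord (b c : realization R K) v : `|val b v - val c v| <= mdist b c.
Proof.
rewrite -sqrtr_sqr ler_wsqrtr // (bigD1 v) //= lerDl.
by apply: sumr_ge0 => w _; exact: sqr_ge0.
Qed.

(** The square of the sum of absolute values dominates the sum of squares, the cross terms being
    nonnegative. *)
Lemma mdist_sum (b c : realization R K) : mdist b c <= \sum_v `|val b v - val c v|.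
Proof.
have s0 : 0 <= \sum_v `|val b v - val c v| by exact: sumr_ge0.
rewrite -[leRHS]ger0_norm // -sqrtr_sqr ler_wsqrtr // expr2 mulr_suml ler_sum // => v _.
rewrite -real_normK ?num_real // expr2 ler_wpM2l // (bigD1 v) //= lerDl.
exact: sumr_ge0.
Qed.

Lemma mdist_le (b c : realization R K) e :
  (forall v, `|val b v - val c v| <= e) -> mdist b c <= k%:R * e.
Proof.
move=> H; apply: le_trans (mdist_sum _ _) _.
by rewrite mulr_natl -sumr_const ler_sum.
Qed.

Lemma realizationP (b : realization R K) :
  [/\ forall v, 0 <= val b v <= 1, \sum_v val b v = 1 &
      exists2 s, s \in K & forall v, v \notin s -> val b v = 0].
Proof.
have /and3P[/forallP b01 /eqP b1 bK] := valP b; split=> //.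
exists [set v | 0 < val b v]%SET => // v; rewrite inE -leNgt => bv.
by apply/eqP; rewrite eq_le bv; case/andP: (b01 v).
Qed.

(** The support lies in the face [s], and it is nonempty because the coordinates sum to 1. *)
Lemma in_realizationP (b : {ffun V -> R}) s :
  s \in K -> (forall v, 0 <= b v) -> \sum_v b v = 1 ->
  (forall v, v \notin s -> b v = 0) -> in_realization K b.
Proof.
case: K_complex => _ _ Ksub sK b0 b1 bs; apply/and3P; split; last 2 first.
- exact/eqP.
- apply: (Ksub s) => //.
    by apply/fintype.subsetP => v; rewrite inE; apply: contraTT => /bs ->; rewrite ltxx.
  apply/negP => /eqP e0; move: b1; rewrite big1 => [/esym/eqP|v _].
    by rewrite oner_eq0.
  apply/eqP; rewrite eq_le b0 andbT leNgt.
  by have := finset.in_set0 v; rewrite -e0 inE => ->.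
- apply/forallP => v; rewrite b0 -b1 (bigD1 v) //= lerDl.
  exact: sumr_ge0.
Qed.

Lemma grid_in_realization N c : (0 < N)%N -> c \in grid k facets N ->
  in_realization K [ffun v => (pcoord c v)%:R / N%:R : R].
Proof.
move=> N0 /gridP[_ cN [s sK cs]]; apply: (in_realizationP sK) => [v||v /cs vs].
- by rewrite ffunE divr_ge0.
- under eq_bigr do rewrite ffunE.
  by rewrite -mulr_suml -natr_sum cN divff // pnatr_eq0 -lt0n.
- by rewrite ffunE vs mul0r.
Qed.

(** Coordinates at most [e] become 0, the others are rounded down, and the missing mass goes to a
    single vertex [v0] with coordinate above [e]. Each vertex loses at most [1 + e N], whence the
    factor [k] in the error at [v0]. *)
Lemma round_exists (b : realization R K) N (e : R) :
  (0 < N)%N -> 0 <= e -> e * k%:R < 1 ->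
  exists2 c, c \in grid k facets N &
    forall v, `|N%:R * val b v - (pcoord c v)%:R| <= k%:R * (1 + e * N%:R) /\
              ((0 < pcoord c v)%N -> e < val b v).
Proof.
move=> N0 e0 ek; have [b01 b1 [s sK bs]] := realizationP b.
(* If all coordinates were at most [e], their sum would be at most [e k < 1]. *)
have [v0 ev0] : exists v0, e < val b v0.
  apply: contrapT => /forallNP H; move: ek; apply/negP; rewrite -leNgt -[leLHS]b1.
  rewrite mulr_natr -sumr_const ler_sum // => v _; rewrite leNgt; exact/negP/H.
pose f v := if e < val b v then Num.truncn (N%:R * val b v) else 0%N.
have Nb v : 0 <= N%:R * val b v by rewrite mulr_ge0 //; case/andP: (b01 v).
have f_le v : (f v)%:R <= N%:R * val b v.
  by rewrite /f; case: ifP => _ //; rewrite truncn_le.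
have f_ge v : N%:R * val b v - (f v)%:R <= 1 + e * N%:R.
  rewrite /f; case: ifPn => [_|]; last first.
    rewrite -leNgt subr0 => be; rewrite mulrC (le_trans (ler_wpM2r _ be)) //.
    by rewrite lerDr.
  have /andP[_ /ltW] := truncn_itv (Nb v).
  by have := mulr_ge0 e0 (ler0n R N); rewrite -natr1; lra.
have sumf : (\sum_(w | w != v0) f w <= N)%N.
  rewrite -(ler_nat R) natr_sum (@le_trans _ _ (\sum_(w | w != v0) N%:R * val b w)) //.
    by apply: ler_sum => w _.
  rewrite -mulr_sumr -[leRHS]mulr1 ler_wpM2l // -[leRHS]b1 [leRHS](bigD1 v0) //= lerDr.
  by case/andP: (b01 v0).
(* By [sumf] this subtraction is not truncated. *)
pose g v := if v == v0 then (N - \sum_(w | w != v0) f w)%N else f v.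
have sumg : (\sum_v g v = N)%N.
  have fg : (\sum_(w | w != v0) g w = \sum_(w | w != v0) f w)%N.
    by apply: eq_bigr => w; rewrite /g => /negbTE ->.
  by rewrite (bigD1 v0) //= fg {1}/g eqxx subnK.
have k1 : 1 <= k%:R :> R by rewrite ler1n; apply/card_gt0P; exists v0.
have e1 : 0 <= 1 + e * N%:R by rewrite addr_ge0 // mulr_ge0.
exists (coords g).
  apply/gridP; split; first exact: size_coords.
    by rewrite -[RHS]sumg; apply: eq_bigr => v _; exact: coord_coords.
  exists s => // v vs; rewrite coord_coords /g; case: eqP => [vv0|_].
    by move: ev0; rewrite -vv0 (bs _ vs) ltNge e0.
  by rewrite /f (bs _ vs) ltNge e0.
move=> v; rewrite coord_coords /g; case: eqP => [->|_]; last first.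
  split; last by rewrite /f; case: ifP.
  rewrite ger0_norm ?subr_ge0 // (le_trans (f_ge v)) //.
  by rewrite -[leLHS]mul1r ler_wpM2r.
split=> //; rewrite natrB // natr_sum.
(* Both vectors have total [N], so the error at [v0] is minus the sum of the other errors. *)
have -> : N%:R * val b v0 - (N%:R - \sum_(w | w != v0) (f w)%:R) =
    - \sum_(w | w != v0) (N%:R * val b w - (f w)%:R).
  rewrite sumrB -mulr_sumr.
  have := b1; rewrite (bigD1 v0) //= => /(congr1 (fun x => N%:R * x)).
  by rewrite mulrDr mulr1; lra.
rewrite normrN (le_trans (ler_norm_sum _ _ _)) //.
rewrite mulr_natl -sumr_const [leRHS](bigD1 v0) //= ler_wpDl // ler_sum // => w _.
by rewrite ger0_norm ?subr_ge0.
Qed.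

End Points.

(** * From tables to continuous operations *)

(** The weighted deviations from the average sum to 0, which is impossible if every value of
    positive weight lies above it. *)
Lemma exists_le_average (R : realFieldType) (I : eqType) (E : seq I) (w y : I -> R) :
  (forall i, 0 <= w i) -> 0 < \sum_(i <- E) w i ->
  exists2 i, i \in E & 0 < w i /\ y i <= (\sum_(i <- E) w i * y i) / \sum_(i <- E) w i.
Proof.
move=> w0 s0; set m := _ / _.
have mE : \sum_(i <- E) w i * (y i - m) = 0.
  under eq_bigr do rewrite mulrBr.
  by rewrite sumrB -mulr_suml /m [_ * (_ / _)]mulrC divfK ?subrr // gt_eqF.
apply: contrapT => H.
have {}H i : i \in E -> 0 < w i -> m < y i.
  move=> iE wi; rewrite ltNge; apply/negP => yi; apply: H; exists i => //.
have ge0 : all (fun i => true ==> (0 <= w i * (y i - m))) E.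
  apply/allP => i iE /=; have := w0 i; rewrite le_eqVlt => /predU1P[<-|wi].
    by rewrite mul0r.
  by rewrite mulr_ge0 ?subr_ge0 // ltW // H.
move: s0; rewrite big_seq_cond big1 ?ltxx // => i; rewrite andbT => iE.
apply/eqP; rewrite eq_le w0 andbT leNgt; apply/negP => wi.
have : 0 < \sum_(i <- E) w i * (y i - m).
  rewrite (big_rem i) //= ltr_pwDl //; first by rewrite mulr_gt0 // subr_gt0 H.
  rewrite big_seq_cond sumr_ge0 // => j; rewrite andbT => /mem_rem jE.
  by have /allP/(_ j jE) := ge0.
by rewrite mE ltxx.
Qed.

Lemma exists_ge_average (R : realFieldType) (I : eqType) (E : seq I) (w y : I -> R) :
  (forall i, 0 <= w i) -> 0 < \sum_(i <- E) w i ->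
  exists2 i, i \in E & 0 < w i /\ (\sum_(i <- E) w i * y i) / \sum_(i <- E) w i <= y i.
Proof.
move=> w0 s0; have [i iE [wi]] := exists_le_average (fun i => - y i) w0 s0.
under eq_bigr do rewrite mulrN.
by rewrite sumrN mulNr lerN2; exists i.
Qed.

Section Soundness.
Variables (R : realType) (V : finType) (K : {set {set V}}).
Hypothesis K_complex : simplicial_complex K.
Local Notation k := #|V|.
Local Notation A := (realization R K).

Lemma cvg_realization (T : Type) (F : set_system T) (FF : Filter F) (f : T -> A) (b : A) :
  (forall v, val (f x) v @[x --> F] --> val b v) -> f @ F --> b.
Proof.
move=> fb U; rewrite -filter_from_ballE => -[e /= e0 bU].
suff : \forall x \near F, mdist b (f x) < e.
  by apply: filterS => x xe; apply: bU; rewrite ballEmdist.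
(* Dividing by [k + 1] makes the bound [k * (e / (k + 1))] strictly smaller than [e]. *)
have e'0 : 0 < e / (k%:R + 1) by rewrite divr_gt0 // ltr_wpDl.
have : \forall x \near F, forall v, `|val b v - val (f x) v| < e / (k%:R + 1).
  by apply: filter_forall => v; have /cvgrPdist_lt := fb v; exact.
apply: filterS => x xe; apply: le_lt_trans (mdist_le (e := e / (k%:R + 1)) _) _.
  by move=> v; exact/ltW.
by rewrite mulrCA gtr_pMr // ltr_pdivrMr ?ltr_wpDl // mul1r ltrDl.
Qed.

Lemma coordinate_continuous v : continuous (fun b : A => val b v : R^o).
Proof.
move=> b; apply/(@cvgrPdist_lt _ _ _ _ (nbhs_filter b)) => e e0.
suff : \forall c \near b, mdist b c < e.
  by apply: filterS => c; apply: le_lt_trans; exact: mdist_coord.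
by have := @nbhsx_ballx R _ b e e0; rewrite ballEmdist.
Qed.

(** * The averaged operation of one table *)

Section Operation.
Variables (n N : nat) (E : seq (seq (seq nat))).
Hypotheses (N_gt0 : (0 < N)%N) (E_ok : table_ok k (facets K) n (grid k (facets K) N) E).

(** A hat function of radius [k + 1] mesh units, strictly more than the rounding error [k], so that
    the entry at the rounded arguments always has positive weight. *)
Definition closeness (a : 'I_n -> A) (xs : seq (seq nat)) (j : 'I_n) (v : V) : R :=
  k.+1%:R - `|N%:R * val (a j) v - (pcoord (nth [::] xs j) v)%:R|.

(* x + |x| is positive where x is and vanishes elsewhere. *)
Definition weight (a : 'I_n -> A) (e : seq (seq nat)) : R :=
  \prod_(j < n) \prod_v
    (closeness a (behead e) j v + `|closeness a (behead e) j v|).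

Lemma weight_ge0 a e : 0 <= weight a e.
Proof.
apply: prodr_ge0 => j _; apply: prodr_ge0 => v _.
by rewrite -lerBlDl sub0r -normrN ler_norm.
Qed.

Lemma weight_gt0 a e :
  0 < weight a e <-> forall j v, 0 < closeness a (behead e) j v.
Proof.
split=> [w0 j v|H]; last first.
  by apply: prodr_gt0 => j _; apply: prodr_gt0 => v _; rewrite addr_gt0 // normr_gt0 gt_eqF.
rewrite ltNge; apply/negP => c0; move: w0.
rewrite /weight (bigD1 j) //= (bigD1 v) //= [X in X * _ * _](_ : _ = 0) ?mul0r ?ltxx //.
by rewrite ler0_norm // subrr.
Qed.

(** The tolerance [k] is what [round_exists] gives for [e = 0]. *)
Definition rounds (a : A) (x : seq nat) :=
  x \in grid k (facets K) N /\ forall v, `|N%:R * val a v - (pcoord x v)%:R| <= k%:R.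

Lemma rounds_exists a : exists x, rounds a x.
Proof.
have [||c cG cP] := round_exists (e := 0) a N_gt0 => //.
exists c; split=> // v; have [+ _] := cP v.
by rewrite mul0r addr0 mulr1.
Qed.

(** Distances at most [k] and less than [k + 1] add up to less than [2 k + 1], hence to at most
    [2 k] between integers. *)
Lemma near_of_weight (a : 'I_n -> A) xs e :
  (forall j, rounds (a j) (nth [::] xs j)) -> 0 < weight a e ->
  near_points k n xs (behead e).
Proof.
move=> axs /weight_gt0 we; apply/allP => j; rewrite mem_iota /= add0n => lt_j.
apply/all_iota_rank => v; have := we (Ordinal lt_j) v.
have [_ /(_ v)] := axs (Ordinal lt_j); rewrite /closeness /= /pcoord.
move: (nth 0%N _ _) (nth 0%N _ _) => x y; move: (N%:R * _) => z.
rewrite subr_gt0 ler_norml ltr_norml => /andP[z1 z2] /andP[z3 z4].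
have nat_le (p q : nat) : p%:R < q%:R + 2 * k%:R + 1 :> R -> (p <= q + k.*2)%N.
  by rewrite -mul2n -natrM -natrD natr1 ltr_nat ltnS.
by rewrite !nat_le //; move: z1 z2 z3 z4; rewrite -natr1; lra.
Qed.

(** The arguments have roundings on the mesh, and the table has an entry there, of positive
    weight. *)
Lemma total_weight_gt0 a : 0 < \sum_(e <- E) weight a e.
Proof.
have /choice[r rP] := fun j => rounds_exists (a j).
case/and3P: E_ok => _ /allP/(_ [seq r j | j <- enum 'I_n]) + _.
rewrite mem_lists size_map size_enum_ord eqxx.
have -> : all (fun x => x \in grid k (facets K) N) [seq r j | j <- enum 'I_n].
  by apply/allP => x /mapP[j _ ->]; have [] := rP j.
move=> /(_ isT) /hasP[e eE /eqP ee]; rewrite (big_rem e) //= ltr_pwDl //; last first.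
  by apply: sumr_ge0 => *; exact: weight_ge0.
apply/weight_gt0 => j v; rewrite ee /closeness subr_gt0.
rewrite (nth_map j) ?size_enum_ord // nth_ord_enum.
by have [_ /(_ v)/le_lt_trans] := rP j; apply; rewrite ltr_nat.
Qed.

Definition average (a : 'I_n -> A) : {ffun V -> R} :=
  [ffun v => (\sum_(e <- E) weight a e * (pcoord (head [::] e) v)%:R) /
             (\sum_(e <- E) weight a e) / N%:R].

(** Entries of positive weight are near the rounded arguments, and the last clause of [table_ok]
    puts their values into one common face; a simplex is convex. *)
Lemma average_in_realization a : in_realization K (average a).
Proof.
have NR0 : N%:R != 0 :> R by rewrite pnatr_eq0 -lt0n.
have s0 := total_weight_gt0 a.
have /choice[r rP] := fun j => rounds_exists (a j).
case/and3P: E_ok => /allP EG _ /allP /(_ [seq r j | j <- enum 'I_n]).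
rewrite mem_lists size_map size_enum_ord eqxx.
have -> : all (fun x => x \in grid k (facets K) N) [seq r j | j <- enum 'I_n].
  by apply/allP => x /mapP[j _ ->]; have [] := rP j.
move=> /(_ isT) /hasP[f fK /allP fE]; have [s sK ffE] := mem_facets fK.
apply: (in_realizationP K_complex sK) => [v||v vs].
- rewrite ffunE !divr_ge0 //; last exact: ltW.
  by apply: sumr_ge0 => e _; rewrite mulr_ge0 ?weight_ge0.
- under eq_bigr do rewrite ffunE.
  rewrite -!mulr_suml exchange_big /=.
  rewrite big_seq_cond (eq_bigr (fun e => weight a e * N%:R)) => [|e]; last first.
    rewrite andbT => eE; rewrite -mulr_sumr -natr_sum.
    by have /gridP[_ -> _] := EG e eE.
  by rewrite -big_seq_cond -mulr_suml mulrAC mulfK // divff // gt_eqF.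
- rewrite ffunE big_seq_cond big1 ?mul0r // => e; rewrite andbT => eE.
  have := weight_ge0 a e; rewrite le_eqVlt => /predU1P[<-|we]; first by rewrite mul0r.
  have := fE e eE; rewrite (near_of_weight _ we) => [|j]; last first.
    by rewrite (nth_map j) ?size_enum_ord // nth_ord_enum.
  by rewrite ffE => /supportedP/(_ _ vs) ->; rewrite mulr0.
Qed.

Definition table_op (a : 'I_n -> A) : A := Sub (average a) (average_in_realization a).

(** In each coordinate the average lies between two values of positive weight, which belong to near
    entries; rounding the average shifts it by at most [k]. *)
Lemma table_op_fits (a : 'I_n -> A) xs y :
  (forall j, rounds (a j) (nth [::] xs j)) -> rounds (table_op a) y ->
  fits k n E xs y.
Proof.
move=> axs [_ ay]; apply/all_iota_rank => v; have := ay v.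
have NR0 : N%:R != 0 :> R by rewrite pnatr_eq0 -lt0n.
rewrite /= ffunE mulrC divfK //; set m := _ / _ => my.
have w0 := weight_ge0 a; have s0 := total_weight_gt0 a.
apply/andP; split; apply/hasP.
- have [e eE [we ym]] := exists_le_average (fun e => (pcoord (head [::] e) v)%:R) w0 s0.
  exists e => //; rewrite (near_of_weight axs we) /= -(ler_nat R) natrD.
  by move: my ym; rewrite /m /pcoord ler_norml; lra.
- have [e eE [we ym]] := exists_ge_average (fun e => (pcoord (head [::] e) v)%:R) w0 s0.
  exists e => //; rewrite (near_of_weight axs we) /= -(ler_nat R) natrD.
  by move: my ym; rewrite /m /pcoord ler_norml; lra.
Qed.

(** Each coordinate is built from the arguments by sums, products, absolute values and a quotient
    whose denominator, the total weight, never vanishes. *)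
Lemma table_op_cvg (F : set_system ('I_n -> A)) (FF : Filter F) (a : 'I_n -> A) :
  (forall j (w : V), val ((b : 'I_n -> A) j) w @[b --> F] --> (val (a j) w : R^o)) ->
  table_op @ F --> table_op a.
Proof.
move=> aj; apply: cvg_realization => v.
have wc e : weight (b : 'I_n -> A) e @[b --> F] --> (weight a e : R^o).
  apply: cvg_big => [|j _]; first exact: mul_continuous.
  apply: cvg_big => [|w _]; first exact: mul_continuous.
  have cc : closeness (b : 'I_n -> A) (behead e) j w @[b --> F] --> (closeness a (behead e) j w : R^o).
    apply: cvgB; first exact: cvg_cst.
    apply: cvg_norm; apply: cvgB; last exact: cvg_cst.
    by apply: cvgM; [exact: cvg_cst|exact: aj].
  by apply: cvgD => //; exact: cvg_norm.
rewrite /= ffunE; under eq_cvg do rewrite /= ffunE.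
apply: cvgM; last exact: cvg_cst.
apply: cvgM.
  apply: cvg_big => [|e _]; first exact: add_continuous.
  by apply: cvgM; [exact: wc|exact: cvg_cst].
apply: cvgV; first by rewrite gt_eqF // total_weight_gt0.
apply: cvg_big => [|e _]; first exact: add_continuous.
exact: wc.
Qed.

Lemma table_op_continuous : continuous (table_op : {ptws 'I_n -> A} -> A).
Proof.
move=> a; apply: (table_op_cvg (nbhs_filter (a : {ptws 'I_n -> A}))) => j w.
have pj : (fun b : {ptws 'I_n -> A} => b j) @ (a : {ptws 'I_n -> A}) --> a j.
  exact: (@proj_continuous _ (fun=> A) j a).
exact: (cvg_comp _ _ pj (@coordinate_continuous w (a j))).
Qed.

End Operation.

End Soundness.

(** * Soundness of certificates *)

Section ComputableReal.
Variables (R : realType) (alpha : R) (p q r : nat -> nat).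
Hypothesis pqrP : forall n, `| ((p n)%:R - (q n)%:R) / (r n).+1%:R - alpha | <= 2 ^- n.

Lemma approx_aboveE a s n :
  approx_above p q r a s n =
  (a%:R < s%:R * (((p n)%:R - (q n)%:R) / (r n).+1%:R - 2 ^- n) :> R).
Proof.
rewrite /approx_above -(ltr_nat R) !natrD !natrM !natrX.
have d0 : 0 < (r n).+1%:R :> R by rewrite ltr0n.
have e0 : 0 < 2 ^+ n :> R by rewrite exprn_gt0.
rewrite -[in RHS](ltr_pM2r (mulr_gt0 e0 d0)).
have -> : s%:R * (((p n)%:R - (q n)%:R) / (r n).+1%:R - 2 ^- n) * (2 ^+ n * (r n).+1%:R) =
  s%:R * 2 ^+ n * (p n)%:R - s%:R * 2 ^+ n * (q n)%:R - s%:R * (r n).+1%:R :> R.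
  by field; rewrite !gt_eqF.
by apply/idP/idP; lra.
Qed.

Lemma approx_above_sound a s n : approx_above p q r a s n -> a%:R < s%:R * alpha.
Proof.
rewrite approx_aboveE => /lt_le_trans; apply; rewrite ler_wpM2l //.
by have := pqrP n; rewrite ler_norml => /andP[_]; rewrite !lerBlDr [alpha + _]addrC.
Qed.

Lemma approx_above_complete a s : (0 < s)%N -> a%:R < s%:R * alpha ->
  exists n, approx_above p q r a s n.
Proof.
(* The approximation may be [2 ^- n] too small and the test subtracts [2 ^- n] once more. The
   resulting loss [2 s / 2 ^ n] must stay below [s alpha - a], which is [(2 s + 1) e]. *)
move=> s0 lt_a; pose e := (s%:R * alpha - a%:R) / (2 * s%:R + 1) : R.
have s0R : 0 < s%:R :> R by rewrite ltr0n.
have e0 : 0 < e by rewrite divr_gt0 ?subr_gt0 // addr_gt0 // mulr_gt0.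
have [n ne] : exists n, 2 ^- n < e.
  exists (Num.truncn e^-1).
  rewrite -[ltRHS]invrK ltf_pV2 ?posrE ?invr_gt0 ?exprn_gt0 //.
  apply: lt_le_trans (truncnS_gt _) _.
  by rewrite -natrX ler_nat ltn_expl.
exists n; rewrite approx_aboveE.
have := pqrP n; rewrite ler_norml => /andP[le_n _].
apply: (@lt_le_trans _ _ (s%:R * (alpha - 2 * 2 ^- n))); last first.
  by rewrite ler_wpM2l //; move: le_n; move: (_ / _) (2 ^- n) => x y; lra.
have : (2 * s%:R + 1) * e = s%:R * alpha - a%:R by rewrite /e mulrC divfK // gt_eqF // addr_gt0 // mulr_gt0.
have : 2 * s%:R * 2 ^- n <= 2 * s%:R * e by rewrite ler_wpM2l // ltW.
by move: e0; move: (2 ^- n) => y; lra.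
Qed.

End ComputableReal.

(** * Numbers that code terms *)

Section TermCodes.
Variable ar : nat -> nat.

Lemma decode_code_var k : CodeSeq.decode (code_term (Var k : term ar)) = [:: 0; k]%N.
Proof. by rewrite CodeSeq.codeK. Qed.

Lemma decode_code_app i (ts : {ffun 'I_(ar i) -> term ar}) :
  CodeSeq.decode (code_term (App i ts)) =
  i.+1 :: [seq code_term (ts j) | j <- enum 'I_(ar i)].
Proof. by rewrite CodeSeq.codeK. Qed.

(** The entries of a list are smaller than its code, so induction on codes covers induction on
    subterms. *)
Lemma code_arg_lt i (ts : {ffun 'I_(ar i) -> term ar}) j :
  (code_term (ts j) < code_term (App i ts))%N.
Proof.
have /allP := CodeSeq.gtn_decode (code_term (App i ts)).
apply; rewrite decode_code_app inE; apply/orP; right.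
by apply: map_f; rewrite mem_enum.
Qed.

Lemma is_var_code_app i (ts : {ffun 'I_(ar i) -> term ar}) :
  is_var_code (code_term (App i ts)) = false.
Proof. by rewrite /is_var_code decode_code_app. Qed.

Lemma code_symbol_app i (ts : {ffun 'I_(ar i) -> term ar}) :
  code_symbol (code_term (App i ts)) = i.
Proof. by rewrite /code_symbol decode_code_app. Qed.

Lemma code_args_app i (ts : {ffun 'I_(ar i) -> term ar}) :
  code_args (code_term (App i ts)) = [seq code_term (ts j) | j <- enum 'I_(ar i)].
Proof. by rewrite /code_args decode_code_app. Qed.

Lemma code_arg_mem i (ts : {ffun 'I_(ar i) -> term ar}) j :
  code_term (ts j) \in code_args (code_term (App i ts)).
Proof.
rewrite code_args_app.
by apply: (map_f (fun j => code_term (ts j))); rewrite mem_enum.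
Qed.

(** A classical inverse of [code_term], with the dummy value [Var 0] off its range. *)
Definition term_of (c : nat) : term ar :=
  if pselect (exists t : term ar, code_term t = c) is left H then projT1 (cid H) else Var 0.

Lemma term_ofK : cancel (@code_term ar) term_of.
Proof.
move=> t; rewrite /term_of; case: pselect => [H|[]]; last by exists t.
by apply: code_term_inj; exact: projT2 (cid H).
Qed.

(** Strong induction on the number: its arguments are smaller and again listed, so the terms they
    code can be assembled. *)
Lemma code_ok_term k KL D codes tabs :
  all (fun c => code_ok ar k KL D codes tabs c) codes ->
  forall c, c \in codes -> exists t : term ar, code_term t = c.
Proof.
move=> /allP ok c; have [n] := ubnP c; elim: n c => // n IHn c lt_cn cc.
have := ok c cc; have := CodeSeq.gtn_decode c; have := CodeSeq.decodeK c.
rewrite /code_ok /is_var_code /code_args /code_symbol.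
case: (CodeSeq.decode c) => [|[|i] args] //= cE /andP[_ /allP lt_args].
  by case: args cE lt_args => [|x [|]] //= cE _ _; exists (Var x); rewrite -cE.
case/and3P => /eqP[] szargs /allP argsc _.
have tP (j : 'I_(ar i)) : exists t : term ar, code_term t = nth 0%N args j.
  have jargs : nth 0%N args j \in args by rewrite mem_nth // szargs.
  apply: IHn; last exact: argsc.
  by rewrite (leq_trans (lt_args _ jargs)) // -ltnS.
have [t {}tP] := choice tP; exists (App i [ffun j => t j]); rewrite -cE.
apply: (congr1 (fun l => CodeSeq.code (i.+1 :: l))); apply: (@eq_from_nth _ 0%N).
  by rewrite size_map size_enum_ord szargs.
move=> j; rewrite size_map size_enum_ord => lt_j.
rewrite -[j]/(val (Ordinal lt_j)) (nth_map (Ordinal lt_j)) ?size_enum_ord // nth_ord_enum ffunE; exact: tP.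
Qed.

End TermCodes.

(** * The averaged algebra realizes a certificate *)

Section Soundness.
Variables (R : realType) (V : finType) (K : {set {set V}}).
Hypothesis K_complex : simplicial_complex K.
Local Notation k := #|V|.
Local Notation A := (realization R K).

Lemma sqdistE (y z : seq nat) :
  (sqdist k y z)%:R = \sum_(v : V) ((pcoord y v)%:R - (pcoord z v)%:R) ^+ 2 :> R.
Proof.
rewrite /sqdist sumnE big_map sum_iota_rank natr_sum; apply: eq_bigr => v _.
rewrite /pcoord; move: (nth _ y _) (nth _ z _) => a b.
have [ab|/ltnW ba] := leqP a b.
  have /eqP -> : (a - b == 0)%N by rewrite subn_eq0.
  by rewrite add0n natrM natrB // -expr2 -sqrrN opprB.
have /eqP -> : (b - a == 0)%N by rewrite subn_eq0.
by rewrite addn0 natrM natrB // -expr2.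
Qed.

(** Triangle inequality through the mesh points of [y] and [z]: in mesh units these are at most [d]
    apart, and each is within [k * k] of the point it rounds, [k] coordinates being off by at most
    [k]. *)
Lemma rounds_mdist N (b c : A) y z d : (0 < N)%N -> rounds N b y -> rounds N c z ->
  (sqdist k y z <= d * d)%N -> N%:R * mdist b c <= (d + 2 * k * k)%:R.
Proof.
move=> N0 [yG by_] [zG cz] yz.
have N0R : 0 < N%:R :> R by rewrite ltr0n.
pose pt x xG : A := Sub [ffun v => (pcoord x v)%:R / N%:R] (grid_in_realization R K_complex N0 xG).
have near (b' : A) x xG : (forall v, `|N%:R * val b' v - (pcoord x v)%:R| <= k%:R) ->
    N%:R * mdist b' (pt x xG) <= (k * k)%:R.
  move=> bx; rewrite -ler_pdivlMl //.
  apply: le_trans (mdist_le (e := N%:R^-1 * k%:R) _) _; last by rewrite mulrCA natrM.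
  move=> v; rewrite /= ffunE ler_pdivlMl // -[X in X * _]ger0_norm // -normrM.
  by rewrite mulrBr [X in _ - X]mulrC divfK ?gt_eqF // bx.
have mid : N%:R * mdist (pt y yG) (pt z zG) <= d%:R.
  rewrite -[N%:R]ger0_norm // -sqrtr_sqr -sqrtrM ?sqr_ge0 //.
  rewrite -[d%:R]ger0_norm // -sqrtr_sqr ler_wsqrtr //.
  have -> : N%:R ^+ 2 * (\sum_v (val (pt y yG) v - val (pt z zG) v) ^+ 2) = (sqdist k y z)%:R.
    rewrite sqdistE mulr_sumr; apply: eq_bigr => v _; rewrite /= !ffunE.
    by field; rewrite gt_eqF.
  by rewrite expr2 -natrM ler_nat.
have tri : mdist b c <= mdist b (pt y yG) + (mdist (pt y yG) (pt z zG) + mdist c (pt z zG)).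
  apply: le_trans (metric_triangle _ (pt y yG) _) _; rewrite lerD2l.
  by apply: le_trans (metric_triangle _ (pt z zG) _) _; rewrite [mdist c _]metric_sym.
apply: le_trans (ler_wpM2l (ltW N0R) tri) _; rewrite !mulrDr.
have := near b y yG by_; have := near c z zG cz; move: mid.
by rewrite !natrD !natrM; lra.
Qed.

Variables (ar : nat -> nat) (b0 : A).

Section Operations.
Variables (N : nat) (tabs : seq (seq (seq (seq nat)))).
Hypothesis N_gt0 : (0 < N)%N.

Local Notation ok i := (table_ok k (facets K) (ar i) (grid k (facets K) N) (nth [::] tabs i)).

(** Symbols without a valid table get the constant [b0], which keeps every operation continuous. *)
Definition table_ops : operations ar A := fun i =>
  match @idP (ok i) with
  | ReflectT H => table_op K_complex N_gt0 H
  | ReflectF _ => fun=> b0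
  end.

Lemma table_ops_continuous : continuous_operations table_ops.
Proof.
move=> i; rewrite /table_ops; case: {-}_ / idP => H; first exact: table_op_continuous.
exact: cst_continuous.
Qed.

Lemma table_ops_fits i (a : 'I_(ar i) -> A) xs y : ok i ->
  (forall j, rounds N (a j) (nth [::] xs j)) -> rounds N (@table_ops i a) y ->
  fits k (ar i) (nth [::] tabs i) xs y.
Proof.
move=> oki; rewrite /table_ops; case: {-}_ / idP => // H.
exact: table_op_fits.
Qed.

End Operations.

Lemma certifies_sound (alpha : R) u N d codes eqs tabs :
  certifies ar k (facets K) u N d codes eqs tabs -> (d + 2 * k * k)%:R < N%:R * alpha ->
  exists2 S : {fset equation ar},
    (lambda (realization R K) [set` S] < alpha%:E)%E & u = code_equations S.
Proof.
case/andP => N0 /and5P[eqs_uniq /eqP uE /allP eqs_ok codes_ok /allP trace_check] lt_alpha.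
have codeP := code_ok_term codes_ok.
have term_ofE c : c \in codes -> code_term (term_of ar c) = c.
  by move=> /codeP[t <-]; rewrite term_ofK.
pose f e : equation ar := (term_of ar (nth 0%N (CodeSeq.decode e) 0),
                           term_of ar (nth 0%N (CodeSeq.decode e) 1)).
have fE e : e \in eqs -> code_equation (f e) = e.
  move=> /eqs_ok/and3P[sz c1 c2]; rewrite -[RHS]CodeSeq.decodeK.
  rewrite -[LHS]/(CodeSeq.code [:: code_term (term_of ar _); code_term (term_of ar _)]).
  by rewrite !term_ofE //; case: (CodeSeq.decode e) sz => [|? [|? []]].
have f_uniq : uniq [seq f e | e <- eqs].
  by rewrite map_inj_in_uniq // => e1 e2 /fE {2}<- /fE {2}<- ->.
pose S := seq_fset tt [seq f e | e <- eqs].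
exists S; last first.
  rewrite /code_equations (perm_big [seq f e | e <- eqs]) /=; last first.
    by have := seq_fset_perm tt [seq f e | e <- eqs]; rewrite undup_id.
  rewrite big_map uE sumnE big_map; apply: eq_big_seq => e eE.
  by rewrite fE.
have N0R : 0 < N%:R :> R by rewrite ltr0n.
(* The infimum is bounded by its value at the averaged algebra. *)
apply: le_lt_trans (ereal_inf_lbound _) _.
  by exists (table_ops tabs N0) => //; exact: table_ops_continuous.
apply: (@le_lt_trans _ _ ((d + 2 * k * k)%:R / N%:R)%:E); last first.
  by rewrite lte_fin ltr_pdivrMr // mulrC.
apply: ge_ereal_sup => _ [->|[e eS [a ->]]]; first by rewrite lee_fin divr_ge0.
rewrite lee_fin ler_pdivlMr // mulrC; move: eS; rewrite /= seq_fsetE => /mapP[e' e'E ->{e}].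
have [rnd rndP] := choice (fun b : A => rounds_exists N0 b).
pose val_of c := term_op (table_ops tabs N0) (term_of ar c) a.
(* The trace to be tested: the rounded true values of the listed terms under the assignment [a]. *)
pose T := [seq rnd (val_of c) | c <- codes].
have lookupE c : c \in codes -> lookup codes T c = rnd (val_of c).
  by move=> cc; rewrite /lookup (nth_map 0%N) ?index_mem // nth_index.
have /trace_check/implyP : T \in lists (size codes) (grid k (facets K) N).
  rewrite mem_lists size_map eqxx; apply/allP => _ /mapP[c _ ->].
  by have [] := rndP (val_of c).
have -> : all (fun c => trace_ok ar k codes tabs T c) codes.
  apply/allP => c cc; have := allP codes_ok c cc.
  have [t tE] := codeP c cc; move: cc; rewrite -{}tE {c}.
  case: t => [x|i ts] cc; first by rewrite /trace_ok /is_var_code decode_code_var.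
  rewrite /code_ok /trace_ok is_var_code_app code_symbol_app.
  case/and3P => _ /allP argsc oki; apply/implyP => _.
  apply: (table_ops_fits (N_gt0 := N0) (a := fun j => term_op (table_ops tabs N0) (ts j) a)) => //.
    move=> j; rewrite code_args_app -map_comp (nth_map j) ?size_enum_ord //.
    rewrite nth_ord_enum /comp lookupE; last exact/argsc/code_arg_mem.
    by have := rndP (val_of (code_term (ts j))); rewrite {1}/val_of term_ofK.
  rewrite lookupE //; have := rndP (val_of (code_term (App i ts))).
  by rewrite {1}/val_of term_ofK.
move=> /(_ isT) /allP /(_ e' e'E) close.
have /and3P[_ c1 c2] := eqs_ok e' e'E.
apply: (@rounds_mdist N _ _ _ _ d N0 (rndP (val_of _)) (rndP (val_of _))).
by rewrite -!lookupE.
Qed.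

End Soundness.

(** * Compactness of the realization *)

Section Compactness.
Variables (R : realType) (V : finType) (K : {set {set V}}).
Hypothesis K_complex : simplicial_complex K.
Local Notation A := (realization R K).

(** By compactness of the unit interval the image ultrafilter clusters somewhere, and an ultrafilter
    converges to its cluster points. *)
Lemma ultra_cvg_unit (T : Type) (F : set_system T) (f : T -> R) :
  UltraFilter F -> (forall t, 0 <= f t <= 1) -> exists2 x : R, 0 <= x & f @ F --> x.
Proof.
move=> UF f01; have PF : ProperFilter F by apply: ultra_proper.
have [x [x01 Fx]] : `[0, 1]%classic `&` cluster (f @ F) !=set0.
  apply: (@segment_compact R 0 1).
  suff : F (f @^-1` `[0, 1]%classic) by [].
  by apply: filterS filterT => t _; rewrite /= in_itv /= f01.
exists x; first by move: x01; rewrite /= in_itv => /andP[].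
move=> U xU; have [//|nU] := in_ultra_setVsetC (f @^-1` U) UF.
by have [y []] := Fx (~` U) U nU xU.
Qed.

(** An ultrafilter has a limit in each coordinate; the point to check is that the support of the
    limit is a face. *)
Lemma realization_compact : compact [set: A].
Proof.
rewrite compact_ultra => F UF _; have PF : ProperFilter F by apply: ultra_proper.
have /choice[x xP] (v : V) : exists x : R, 0 <= x /\ (fun b : A => val b v) @ F --> x.
  have [|x x0 xF] := @ultra_cvg_unit _ F (fun b : A => val b v) UF; last by exists x.
  by move=> b; have [/(_ v)] := realizationP b.
have x0 v : 0 <= x v by have [] := xP v.
have xF v : (fun b : A => val b v) @ F --> x v by have [] := xP v.
have x1 : \sum_v x v = 1.
  have cs : (fun b : A => \sum_v val b v) @ F --> \sum_v x v.
    by apply: cvg_big => [|v _]; [exact: add_continuous|exact: xF].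
  have c1 : (fun b : A => \sum_v val b v) @ F --> (1 : R).
    have -> : (fun b : A => \sum_v val b v) = cst (1 : R).
      by apply/funext => b; have [_ -> _] := realizationP b.
    exact: cvg_cst.
  exact: (cvg_unique (@Rhausdorff R) cs c1).
(* Positivity at the finitely many vertices where the limit is positive holds near the limit, so
   some point of [A] satisfies all of it. The limit is then supported in the face supporting that
   point. *)
have [c cx] : exists c : A, forall v, 0 < x v -> 0 < val c v.
  apply: (@filter_ex _ F); apply: filter_forall => v.
  have [xv|xv] := ltP 0 (x v).
    by apply: filterS (cvgr_gt _ (xF v) _ xv) => c ? _.
  by apply: filterS filterT.
have [_ _ [s sK cs]] := realizationP c.
have bK : in_realization K [ffun v => x v].
  apply: (in_realizationP K_complex sK) => [v||v /cs cv].
  - by rewrite ffunE.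
  - by under eq_bigr do rewrite ffunE.
  - rewrite ffunE; apply/eqP; rewrite eq_le x0 andbT leNgt; apply/negP => /cx.
    by rewrite cv ltxx.
exists (Sub _ bK); split=> //; apply: cvg_realization => v.
by rewrite /= ffunE; exact: xF.
Qed.

(** The filter generated by the boxes around [a] converges to [a] in every coordinate, hence
    pointwise, so it contains all neighbourhoods of [a]. *)
Lemma box_cvg n (a : 'I_n -> A) (W : set {ptws 'I_n -> A}) :
  nbhs (a : {ptws 'I_n -> A}) W ->
  exists2 rho : R, 0 < rho & forall b : 'I_n -> A, (forall j, mdist (a j) (b j) < rho) -> W b.
Proof.
pose box (rho : R) := [set b : 'I_n -> A | forall j, mdist (a j) (b j) < rho].
pose B := filter_from [set rho : R | 0 < rho] box.
have FB : Filter B.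
  apply: filter_from_filter; first by exists 1 => /=.
  move=> e1 e2 /= e10 e20; exists (Num.min e1 e2); first by rewrite /= lt_min e10.
  by move=> b bj; split=> j; have := bj j; rewrite lt_min => /andP[].
have : {ptws, B --> a}.
  apply/cvg_sup => j; apply/cvg_image.
    by apply/seteqP; split=> // c _; exists (fun=> c).
  move=> U; rewrite -filter_from_ballE => -[e /= e0 aU].
  exists ((fun b : 'I_n -> A => b j) @^-1` U).
    by exists e => // b /(_ j) ab; apply: aU; rewrite ballEmdist.
  by apply/seteqP; split=> [_ [b bU <-] //|c cU]; exists (fun=> c).
by move=> /[apply] -[e e0 eW]; exists e.
Qed.

(** The Heine-Cantor theorem on the finite power of [A], compact by Tychonoff. *)
Lemma unif_continuous_op n (f : ('I_n -> A) -> A) (e : R) :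
  continuous (f : {ptws 'I_n -> A} -> A) -> 0 < e ->
  exists2 d : R, 0 < d & forall a b : 'I_n -> A,
    (forall j, mdist (a j) (b j) < d) -> mdist (f a) (f b) < e.
Proof.
move=> cf e0.
have e2 : 0 < e / 2 by rewrite divr_gt0.
pose P (d : R) (a : {ptws 'I_n -> A}) := forall b : 'I_n -> A,
  (forall j, mdist (a j) (b j) < d) -> mdist (f a) (f b) < e.
(* With both [a'] within [rho / 2] of [a] and [d < rho / 2], the points [a'] and [b] lie in the box
   of radius [rho] on which [f] varies by less than [e / 2] from [f a]. *)
have Ploc (a : {ptws 'I_n -> A}) : \forall a' \near a & d \near (0 : R)^'+, P d a'.
  have [|rho rho0 fW] := @box_cvg n a (f @^-1` ball (f a) (e / 2)).
    by apply: cf; exact: nbhsx_ballx.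
  have rho2 : 0 < rho / 2 by rewrite divr_gt0.
  exists ([set b | forall j, mdist (a j) (b j) < rho / 2], [set d | d < rho / 2]).
    split; last exact: nbhs_right_lt.
    apply: (@filter_forall _ _ _ _ (nbhs_filter a)) => j.
    have : nbhs (a j) [set b | mdist (a j) b < rho / 2].
      by have := @nbhsx_ballx R _ (a j) _ rho2; rewrite ballEmdist.
    by move/(@proj_continuous _ (fun=> A) j a).
  move=> [a' d] [/= a'W d_lt] b bW.
  have fa b' : (forall j, mdist (a j) (b' j) < rho) -> mdist (f a) (f b') < e / 2.
    by move/fW; rewrite /= ballEmdist.
  apply: le_lt_trans (metric_triangle _ (f a) _) _.
  rewrite [e]splitr ltrD //; first rewrite metric_sym.
    by apply: fa => j; apply: lt_trans (a'W j) _; rewrite ltr_pdivrMr // mulr_natr mulr2n ltrDl.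
  apply: fa => j; apply: le_lt_trans (metric_triangle _ (a' j) _) _.
  by rewrite [rho]splitr ltrD // (lt_trans (bW j)).
have /compact_near_coveringP := tychonoff (fun _ : 'I_n => realization_compact).
move=> /(_ R (0^'+) P _ (fun a _ => Ploc a)) nearP.
have [d [d0 dP]] := filter_ex (filterI (nbhs_right_gt (0 : R)) nearP).
by exists d => // a b; exact: dP.
Qed.

End Compactness.

(** * Completeness of certificates *)

(** Each condition holds for all small positive radii, and finitely many such conditions hold
    together; the right neighbourhoods of 0 also cover an empty [I]. *)
Lemma common_radius (R : realType) (I : finType) (P : I -> R -> Prop) :
  (forall i d d', d' <= d -> P i d -> P i d') ->
  (forall i, exists2 d : R, 0 < d & P i d) ->
  exists2 d : R, 0 < d & forall i, P i d.
Proof.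
move=> Pmono Pex.
have Pnear : \forall d \near (0 : R)^'+, forall i, P i d.
  apply: filter_forall => i; have [d d0 Pd] := Pex i.
  by apply: filterS (nbhs_right_lt d0) => d' /ltW /Pmono; exact.
have [d [d0 dP]] := filter_ex (filterI (nbhs_right_gt (0 : R)) Pnear).
by exists d.
Qed.

(** * Approximate evaluation of terms *)

Section Completeness.
Variables (R : realType) (V : finType) (K : {set {set V}}).
Hypothesis K_complex : simplicial_complex K.
Local Notation k := #|V|.
Local Notation A := (realization R K).
Variables (ar : nat -> nat) (G : operations ar A).
Hypothesis G_continuous : continuous_operations G.

Definition approx_trace (bound : nat) (theta : R) (T : term ar -> A) : Prop :=
  forall i (ts : {ffun 'I_(ar i) -> term ar}), (code_term (App i ts) < bound)%N ->
    mdist (T (App i ts)) (G (fun j => T (ts j))) < theta.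

Lemma approx_traceS bound theta theta' T :
  theta <= theta' -> approx_trace bound theta T -> approx_trace bound theta' T.
Proof. by move=> le_t H i ts lt_b; exact: lt_le_trans (H i ts lt_b) le_t. Qed.

(** Induction on the term: half of [eta] is left for the error at the root, and the arguments are
    made accurate enough for uniform continuity to keep the other half. *)
Lemma approx_trace_term bound (t : term ar) (eta : R) : 0 < eta -> (code_term t < bound)%N ->
  exists2 theta : R, 0 < theta & forall T, approx_trace bound theta T ->
    mdist (T t) (term_op G t (fun x => T (Var x))) < eta.
Proof.
elim/term_ind': t eta => [x|i ts IH] eta eta0 lt_b.
  by exists 1 => // T _; rewrite mdistxx.
have eta2 : 0 < eta / 2 by rewrite divr_gt0.
have [d d0 Gd] := unif_continuous_op K_complex (@G_continuous i) eta2.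
have [|j|theta theta0 H] := @common_radius R 'I_(ar i) (fun j theta =>
    forall T, approx_trace bound theta T ->
    mdist (T (ts j)) (term_op G (ts j) (fun x => T (Var x))) < d).
- by move=> j e e' le_e H T Ta; apply: H; exact: approx_traceS Ta.
- by apply: IH => //; apply: ltn_trans (code_arg_lt ts j) lt_b.
exists (Num.min theta (eta / 2)); first by rewrite lt_min theta0.
move=> T Ta; apply: le_lt_trans (metric_triangle _ (G (fun j => T (ts j))) _) _.
rewrite [eta]splitr ltrD //.
  apply: lt_le_trans (Ta i ts lt_b) _; by rewrite ge_min lexx orbT.
apply: Gd => j; apply: H; apply: approx_traceS Ta.
by rewrite ge_min lexx.
Qed.

(** Only finitely many codes lie below [bound], so one [theta] serves all of these terms. *)
Lemma approx_trace_terms bound (eta : R) : 0 < eta ->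
  exists2 theta : R, 0 < theta & forall T, approx_trace bound theta T ->
    forall t, (code_term t < bound)%N ->
    mdist (T t) (term_op G t (fun x => T (Var x))) < eta.
Proof.
move=> eta0.
have [|c|theta theta0 H] := @common_radius R 'I_bound (fun c theta =>
    forall T, approx_trace bound theta T -> forall t, code_term t = c ->
    mdist (T t) (term_op G t (fun x => T (Var x))) < eta).
- by move=> j e e' le_e H T Ta; apply: H; exact: approx_traceS Ta.
- have [[t tc]|nt] := pselect (exists t : term ar, code_term t = c); last first.
    by exists 1 => // T _ t tc; case: nt; exists t.
  have [|theta theta0 H] := @approx_trace_term bound t eta eta0; first by rewrite tc.
  by exists theta => // T Ta t'; rewrite -tc => /code_term_inj ->; exact: H.
by exists theta => // T Ta t lt_t; apply: (H (Ordinal lt_t) T Ta).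
Qed.

(** * Tabulating continuous operations on a mesh *)

Section Table.
Variables (b0 : A) (bound N : nat) (eps delta theta : R).
Hypotheses (N_gt0 : (0 < N)%N) (eps_gt0 : 0 < eps) (eps_small : eps * k%:R < 1).
Hypothesis delta_unif : forall i, (i < bound)%N -> forall a b : 'I_(ar i) -> A,
  (forall j, mdist (a j) (b j) < delta) -> mdist (G a) (G b) < eps.
(** Near mesh points differ by at most [2 k / N] in each of [k] coordinates, so this puts them
    within the modulus [delta]. *)
Hypothesis delta_N : k%:R * (2 * k%:R / N%:R) < delta.
(** Error per coordinate: [eps] from moving to a near argument, [k eps + k / N] from rounding the
    value, and [k / N] from the slack in [fits]. *)
Hypothesis theta_big : k%:R * (eps + k%:R * eps + 2 * k%:R / N%:R) < theta.

Local Notation D := (grid k (facets K) N).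

Let N0R : 0 < N%:R :> R. Proof. by rewrite ltr0n. Qed.

Definition grid_point (c : seq nat) : A :=
  if pselect (c \in D) is left cD then
    Sub [ffun v => (pcoord c v)%:R / N%:R] (grid_in_realization R K_complex N_gt0 cD)
  else b0.

Lemma val_grid_point c v : c \in D -> val (grid_point c) v = (pcoord c v)%:R / N%:R.
Proof. by rewrite /grid_point; case: pselect => // cD _; rewrite /= ffunE. Qed.

Lemma mdist_grid_point c (b : A) e : c \in D ->
  (forall v, `|(pcoord c v)%:R - N%:R * val b v| <= N%:R * e) ->
  mdist (grid_point c) b <= k%:R * e.
Proof.
move=> cD H; apply: mdist_le => v; rewrite val_grid_point //.
rewrite -(ler_pM2l N0R) -[X in X * `|_|]ger0_norm ?(ltW N0R) // -normrM mulrBr.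
by rewrite [N%:R * (_ / _)]mulrC divfK ?gt_eqF // H.
Qed.

(** The cut-off is [eps] here, so coordinates up to [eps] disappear. *)
Definition rounding (b : A) : seq nat :=
  s2val (cid2 (round_exists b N_gt0 (ltW eps_gt0) eps_small)).

Lemma rounding_grid b : rounding b \in D.
Proof. exact: s2valP (cid2 (round_exists b N_gt0 (ltW eps_gt0) eps_small)). Qed.

Lemma rounding_near (b : A) (v : V) :
  `|N%:R * val b v - (pcoord (rounding b) v)%:R| <= k%:R * (1 + eps * N%:R).
Proof. by have [] := s2valP' (cid2 (round_exists b N_gt0 (ltW eps_gt0) eps_small)) v. Qed.

Lemma rounding_support (b : A) (v : V) : val b v <= eps -> pcoord (rounding b) v = 0%N.
Proof.
have [_ H] := s2valP' (cid2 (round_exists b N_gt0 (ltW eps_gt0) eps_small)) v.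
by move=> b_le; apply/eqP; rewrite -leqn0 leqNgt; apply/negP => /H; rewrite ltNge b_le.
Qed.

Definition table i : seq (seq (seq nat)) :=
  [seq rounding (G (fun j : 'I_(ar i) => grid_point (nth [::] xs j))) :: xs
     | xs <- lists (ar i) D].

Lemma near_points_mdist n (xs ys : seq (seq nat)) (j : 'I_n) :
  xs \in lists n D -> ys \in lists n D -> near_points k n xs ys ->
  mdist (grid_point (nth [::] xs j)) (grid_point (nth [::] ys j)) < delta.
Proof.
rewrite !mem_lists => /andP[/eqP sx /allP xsD] /andP[/eqP sy /allP ysD] near.
have xD : nth [::] xs j \in D by apply: xsD; rewrite mem_nth ?sx.
have yD : nth [::] ys j \in D by apply: ysD; rewrite mem_nth ?sy.
apply: le_lt_trans delta_N; apply: mdist_grid_point => // v.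
rewrite val_grid_point // mulrC [N%:R * _]mulrC !divfK ?gt_eqF //.
have /allP/(_ j) := near; rewrite mem_iota /= ltn_ord => /(_ isT)/all_iota_rank/(_ v).
rewrite /pcoord -addnn -!(ler_nat R) !natrD ler_norml.
by move=> /andP[h1 h2]; apply/andP; split; lra.
Qed.

(** For the common face take one supporting the value [b] at [xs]: a value at near arguments is
    within [eps] of [b], so off that face its coordinates are at most [eps] and are rounded to 0. *)
Lemma table_table_ok i : (i < bound)%N -> table_ok k (facets K) (ar i) D (table i).
Proof.
move=> lt_i; apply/and3P; split; apply/allP.
- by move=> e /mapP[xs _ ->]; exact: rounding_grid.
- move=> xs xsD; apply/hasP.
  exists (rounding (G (fun j : 'I_(ar i) => grid_point (nth [::] xs j))) :: xs).
    by rewrite map_f.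
  exact: eqxx.
move=> xs xsD; pose b := G (fun j : 'I_(ar i) => grid_point (nth [::] xs j)).
have [_ _ [s sK bs]] := realizationP b.
apply/hasP; exists [seq (enum_rank v : nat) | v <- enum s]; first exact: facet_mem.
apply/allP => _ /mapP[ys ysD ->] /=; apply/implyP => near.
apply/supportedP => v /bs bv; apply: rounding_support.
set b' := G _; have : mdist b b' < eps.
  by apply: delta_unif => // j; exact: near_points_mdist.
move/(le_lt_trans (mdist_coord b b' v)); rewrite bv sub0r normrN.
by move/(le_lt_trans (ler_norm _))/ltW.
Qed.

(** Each coordinate of [y] is squeezed, up to [k], between entries at near arguments, and these
    entries are close to the true value at [xs] by uniform continuity. *)
Lemma table_fits i xs y : (i < bound)%N -> xs \in lists (ar i) D -> y \in D ->
  fits k (ar i) (table i) xs y ->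
  mdist (grid_point y) (G (fun j : 'I_(ar i) => grid_point (nth [::] xs j))) < theta.
Proof.
move=> lt_i xsD yD /all_iota_rank fit; apply: le_lt_trans theta_big.
set b := G _; apply: mdist_grid_point => // v.
have near_b ys : ys \in lists (ar i) D -> near_points k (ar i) xs ys ->
    let c := rounding (G (fun j : 'I_(ar i) => grid_point (nth [::] ys j))) in
    `|N%:R * val b v - (pcoord c v)%:R| <= N%:R * eps + k%:R * (1 + eps * N%:R).
  move=> ysD near; set b' := G _ => /=.
  have bb' : mdist b b' < eps by apply: delta_unif => // j; exact: near_points_mdist.
  have -> : N%:R * val b v - (pcoord (rounding b') v)%:R =
      N%:R * (val b v - val b' v) + (N%:R * val b' v - (pcoord (rounding b') v)%:R).
    by rewrite mulrBr addrA subrK.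
  rewrite (le_trans (ler_normD _ _)) // lerD ?rounding_near //.
  rewrite normrM ger0_norm ?(ltW N0R) // ler_wpM2l ?(ltW N0R) //.
  by apply: le_trans (ltW bb'); exact: mdist_coord.
have -> : N%:R * (eps + k%:R * eps + 2 * k%:R / N%:R) =
    N%:R * eps + k%:R * (1 + eps * N%:R) + k%:R by field; rewrite gt_eqF.
have /andP[/hasP[e1 /mapP[ys1 ys1D ->] /andP[near1 le1]]
           /hasP[e2 /mapP[ys2 ys2D ->] /andP[near2 le2]]] := fit v.
move: (near_b ys1 ys1D near1) (near_b ys2 ys2D near2) le1 le2.
rewrite /= /pcoord -!(ler_nat R) !natrD !ler_norml.
move: (nth _ y _)%:R (nth _ (rounding _) _)%:R (nth _ (rounding _) _)%:R => y1 y2 y3.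
move: (N%:R * val b v) (N%:R * eps + k%:R * (1 + eps * N%:R)) => z1 z2.
by move=> /andP[? ?] /andP[? ?] ? ?; apply/andP; split; lra.
Qed.

End Table.

(** Closed under subterms, since arguments have smaller codes. The certificate only has to exist, so
    a classical filter is harmless. *)
Definition codes_below (bound : nat) : seq nat :=
  [seq c <- iota 0 bound | `[< exists t : term ar, code_term t = c >]].

Lemma codes_belowP bound c :
  reflect ((c < bound)%N /\ exists t : term ar, code_term t = c) (c \in codes_below bound).
Proof.
rewrite mem_filter mem_iota /= add0n.
by apply: (iffP andP) => -[]; [move=> /asboolP|move=> ? /asboolP].
Qed.

Lemma code_term_below bound (t : term ar) :
  (code_term t \in codes_below bound) = (code_term t < bound)%N.
Proof. by apply/codes_belowP/idP => [[]//|]; split=> //; exists t. Qed.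

Lemma certifies_complete (b0 : A) (S : {fset equation ar}) (alpha alpha' : R) :
  0 <= alpha' -> alpha' < alpha ->
  (forall e a, e \in S -> mdist (term_op G e.1 a) (term_op G e.2 a) <= alpha') ->
  exists N d codes eqs tabs,
    [/\ (0 < N)%N, (d + 2 * k * k)%:R < N%:R * alpha &
     certifies ar k (facets K) (code_equations S) N d codes eqs tabs].
Proof.
move=> alpha0 lt_alpha GS.
have k0 : 0 < k%:R :> R.
  rewrite ltr0n; apply/card_gt0P; have [_ b1 _] := realizationP b0.
  have [v _] : exists v : V, true.
    apply: contrapT => noV; move: b1; rewrite big1 => [/esym/eqP|v]; first by rewrite oner_eq0.
    by case: noV; exists v.
  by exists v.
pose bound := (\sum_(e <- S) (code_term e.1 + code_term e.2)).+1.
have S_bound e : e \in S -> (code_term e.1 < bound)%N /\ (code_term e.2 < bound)%N.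
  move=> eS; rewrite /bound (big_rem e) //= !ltnS; split.
    by rewrite -addnA leq_addr.
  by rewrite addnAC leq_addl.
(* The gap is split in four: two parts for the deviation of the two sides of an equation from true
   evaluation, two for rounding [d] up and for the term [2 k k]. *)
have [eta eta0 etaE] : exists2 eta : R, 0 < eta & 4 * eta = alpha - alpha'.
  by exists ((alpha - alpha') / 4); [rewrite divr_gt0 // subr_gt0|rewrite mulrC divfK].
have [theta theta0 thetaP] := approx_trace_terms bound eta0.
(* The first bound gives [eps k < 1], needed for rounding; the second keeps the [eps] part of
   [theta_big] at most [theta / 2]. *)
pose eps := Num.min (1 / (2 * k%:R)) (theta / (2 * (k%:R * (1 + k%:R)))).
have kk0 : 0 < 2 * (k%:R * (1 + k%:R)) :> R by rewrite !mulr_gt0 // addr_gt0.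
have eps0 : 0 < eps by rewrite lt_min !divr_gt0 // mulr_gt0.
have eps_small : eps * k%:R < 1.
  apply: (@le_lt_trans _ _ (1 / (2 * k%:R) * k%:R)).
    by rewrite ler_wpM2r ?(ltW k0) // ge_min lexx.
  have -> : 1 / (2 * k%:R) * k%:R = 2^-1 :> R by field; rewrite gt_eqF.
  by rewrite invf_lt1 // ltr1n.
have [|i|delta delta0 deltaP] := @common_radius R 'I_bound (fun i delta =>
   forall a b : 'I_(ar i) -> A,
  (forall j, mdist (a j) (b j) < delta) -> mdist (G a) (G b) < eps).
- by move=> i d d' le_d H a b ab; apply: H => j; exact: lt_le_trans (ab j) le_d.
- exact: unif_continuous_op (@G_continuous i) eps0.
(* Lower bounds on the mesh: [x1] yields [delta_N], [x2] makes the mesh part of [theta_big] less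
   than [theta / 2], and [x3] gives [1 + 2 k k < 2 eta N]. *)
pose x1 := 2 * k%:R * k%:R / delta; pose x2 := 4 * k%:R * k%:R / theta.
pose x3 := (1 + 2 * k%:R * k%:R) / (2 * eta) : R.
have [N [N0 [N1 N2 N3]]] : exists N, (0 < N)%N /\ [/\ x1 < N%:R, x2 < N%:R & x3 < N%:R].
  exists (Num.truncn (Num.max x1 (Num.max x2 x3))).+1; split=> //.
  by split; apply: le_lt_trans (truncnS_gt _); rewrite !le_max lexx ?orbT.
have N0R : 0 < N%:R :> R by rewrite ltr0n.
have delta_N : k%:R * (2 * k%:R / N%:R) < delta.
  move: N1; rewrite /x1 ltr_pdivrMr // => N1.
  by rewrite mulrA ltr_pdivrMr // [delta * _]mulrC; lra.
have theta_big : k%:R * (eps + k%:R * eps + 2 * k%:R / N%:R) < theta.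
  have e2 : k%:R * (2 * k%:R / N%:R) < theta / 2.
    move: N2; rewrite /x2 ltr_pdivrMr // => N2.
    by rewrite mulrA ltr_pdivrMr // mulrAC ltr_pdivlMr // [theta * _]mulrC; lra.
  have e1 : k%:R * (1 + k%:R) * eps <= theta / 2.
    apply: (@le_trans _ _ (k%:R * (1 + k%:R) * (theta / (2 * (k%:R * (1 + k%:R)))))).
      by rewrite ler_wpM2l ?mulr_ge0 ?addr_ge0 // ge_min lexx orbT.
    rewrite le_eqVlt; apply/orP; left; apply/eqP; field.
    by rewrite !gt_eqF // addr_gt0.
  by move: e1 e2; rewrite !mulrDr !mulrDl; lra.
pose tabs := mkseq (table b0 N0 eps0 eps_small) bound.
(* The successor makes [d] an upper bound of the truncated real, at a cost of at most 1, which [x3]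
   accounts for. *)
pose d := (Num.truncn (N%:R * (alpha' + 2 * eta))).+1.
have a2 : 0 <= alpha' + 2 * eta by rewrite addr_ge0 // mulr_ge0 // ltW.
exists N, d, (codes_below bound), [seq code_equation e | e <- S], tabs; split=> //.
  have := truncn_le (N%:R * (alpha' + 2 * eta)).
  rewrite mulr_ge0 ?(ltW N0R) // => dN.
  move: N3; rewrite /x3 ltr_pdivrMr ?mulr_gt0 // => N3.
  have := congr1 (fun x => N%:R * x) etaE.
  by rewrite /d natrD natrM natrM -natr1; move: dN N3; rewrite !mulrDr; lra.
have lookupD T t : T \in lists (size (codes_below bound)) (grid k (facets K) N) ->
    (code_term t < bound)%N ->
    lookup (codes_below bound) T (@code_term ar t) \in grid k (facets K) N.
  rewrite mem_lists => /andP[/eqP szT /allP TD] lt_t; apply: TD.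
  by rewrite /lookup mem_nth // szT index_mem code_term_below.
have codes_term c : c \in codes_below bound -> exists t : term ar, code_term t = c.
  by case/codes_belowP.
have tabsE i (ts : {ffun 'I_(ar i) -> term ar}) : (code_term (App i ts) < bound)%N ->
    (i < bound)%N /\ nth [::] tabs i = table b0 N0 eps0 eps_small i.
  (* The head entry [i.+1] of the code is smaller than the code, so tables for the symbols below
     [bound] suffice. *)
  move=> lt_b; have lt_i : (i < bound)%N.
    apply: ltn_trans lt_b; have /allP := CodeSeq.gtn_decode (code_term (App i ts)).
    move=> /(_ i.+1); rewrite decode_code_app inE eqxx => /(_ isT); exact: ltnW.
  by split=> //; rewrite nth_mkseq.
have delta_unif i : (i < bound)%N -> forall a b : 'I_(ar i) -> A,
    (forall j, mdist (a j) (b j) < delta) -> mdist (G a) (G b) < eps.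
  by move=> lt_i; exact: (deltaP (Ordinal lt_i)).
apply/andP; split=> //; apply/and5P; split.
- rewrite map_inj_uniq ?fset_uniq // => -[t1 t2] [t1' t2'].
  by move=> /(can_inj CodeSeq.codeK)[/code_term_inj -> /code_term_inj ->].
- by rewrite /code_equations sumnE !big_map.
- apply/allP => _ /mapP[e eS ->]; have [e1 e2] := S_bound e eS.
  by rewrite /equation_code_ok CodeSeq.codeK [nth _ _ 0]/= [nth _ _ 1]/= !code_term_below e1 e2.
- apply/allP => c cc; have [t tc] := codes_term c cc; move: cc; rewrite -{}tc {c}.
  case: t => [x|i ts]; first by rewrite /code_ok /is_var_code decode_code_var.
  rewrite code_term_below => lt_b; have [lt_i tabsi] := tabsE i ts lt_b.
  rewrite /code_ok is_var_code_app code_symbol_app tabsi; apply/and3P; split.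
  + by rewrite decode_code_app /= size_map size_enum_ord.
  + apply/allP => c; rewrite code_args_app => /mapP[j _ ->].
    by rewrite code_term_below (ltn_trans (code_arg_lt ts j)).
  + exact: (table_table_ok b0 N0 eps0 eps_small delta_unif delta_N lt_i).
apply/allP => T TD; apply/implyP => /allP T_ok; apply/allP => _ /mapP[e eS ->].
have [e1 e2] := S_bound e eS.
pose P := grid_point b0 N0.
(* A tested list of mesh points becomes an assignment of points to terms; passing [trace_ok] makes
   it an approximate trace. *)
pose tr (t : term ar) := P (lookup (codes_below bound) T (code_term t)).
have tr_approx : approx_trace bound theta tr.
  move=> i ts lt_b; have [lt_i tabsi] := tabsE i ts lt_b.
  have args_b j : (code_term (ts j) < bound)%N by exact: ltn_trans (code_arg_lt ts j) lt_b.
  have := T_ok (code_term (App i ts)); rewrite code_term_below => /(_ lt_b).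
  rewrite /trace_ok is_var_code_app code_symbol_app tabsi => /implyP/(_ isT).
  set xs := [seq _ | _ <- code_args _] => fit.
  have xsE (j : 'I_(ar i)) : nth [::] xs j = lookup (codes_below bound) T (code_term (ts j)).
    rewrite /xs code_args_app -map_comp (nth_map j) ?size_enum_ord //.
    by rewrite nth_ord_enum.
  have -> : (fun j => tr (ts j)) = (fun j => P (nth [::] xs j)).
    by apply/funext => j; rewrite xsE.
  apply: (table_fits delta_unif delta_N theta_big lt_i _ _ fit); last exact: lookupD.
  rewrite mem_lists /xs code_args_app -map_comp size_map size_enum_ord eqxx.
  by apply/allP => _ /mapP[j _ ->]; exact: lookupD.
(* The points attached to the variables form the assignment at which the hypothesis on [G] is
   applied. *)
set a := fun x => tr (Var x).
have lt_tr : mdist (tr e.1) (tr e.2) < alpha' + 2 * eta.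
  have t1 := thetaP tr tr_approx e.1 e1; have t2 := thetaP tr tr_approx e.2 e2.
  have t3 := GS e a eS.
  have t4 := metric_triangle (tr e.1) (term_op G e.1 a) (tr e.2).
  have t5 := metric_triangle (term_op G e.1 a) (term_op G e.2 a) (tr e.2).
  by rewrite metric_sym in t2; move: t1 t2 t3 t4 t5; rewrite -/a; lra.
rewrite /close_sides CodeSeq.codeK [nth _ _ 0]/= [nth _ _ 1]/=.
set y := lookup _ _ _; set z := lookup _ _ _.
have yD : y \in grid k (facets K) N by exact: lookupD.
have zD : z \in grid k (facets K) N by exact: lookupD.
rewrite -(ler_nat R) sqdistE natrM -expr2.
have d_ge : N%:R * (alpha' + 2 * eta) <= d%:R by exact/ltW/truncnS_gt.
apply: (@le_trans _ _ ((N%:R * mdist (tr e.1) (tr e.2)) ^+ 2)); last first.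
  rewrite ler_pXn2r ?nnegrE ?mulr_ge0 ?mdist_ge0 ?(ltW N0R) //.
  by apply: le_trans d_ge; rewrite ler_wpM2l ?(ltW N0R) // ltW.
rewrite exprMn -[mdist _ _]/(Num.sqrt _) sqr_sqrtr; last by apply: sumr_ge0 => *; exact: sqr_ge0.
rewrite mulr_sumr ler_sum // => v _; rewrite !val_grid_point // -/y -/z.
by rewrite -exprMn mulrBr ![N%:R * (_ / _)]mulrC !divfK ?gt_eqF.
Qed.

End Completeness.

(** * Recursive enumerability of the set of indices *)

Lemma recursively_enumerable0 : recursively_enumerable set0.
Proof.
exists (fun=> 1%N); first exact: recursive_const.
by move=> n; split=> // -[].
Qed.

Theorem corollary37 (R : realType) (V : finType) (K : {set {set V}})
    (alpha : R) (ar : nat -> nat)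
    (K_complex : simplicial_complex K)
    (alpha_gt0 : 0 < alpha) (alpha_computable : computable_real alpha)
    (ar_recursive : recursive1 ar)
    (ar_infinitely_often : forall n N : nat, exists2 i, (N <= i)%N & ar i = n) :
  recursively_enumerable
    [set u | exists2 S : {fset equation ar},
       (lambda (realization R K) [set` S] < alpha%:E)%E & u = code_equations S].
Proof.
have [p [q [r [rp rq rr pqrP]]]] := alpha_computable.
have lambda_lt (S : {fset equation ar}) :
    (lambda (realization R K) [set` S] < alpha%:E)%E ->
    exists2 G : operations ar (realization R K), continuous_operations G &
      (lambda_algebra G [set` S] < alpha%:E)%E.
  by move=> /ereal_inf_lt[_ [G cG <-] ltG]; exists G.
(* On an empty realization there is no algebra at all, since a nullary symbol would name a point; no
   set of equations then has [lambda] below [alpha]. *)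
have [[b0 _]|empty] := pselect (exists b0 : realization R K, True); last first.
  rewrite (_ : [set u | _] = set0); first exact: recursively_enumerable0.
  apply/seteqP; split=> // u [S /lambda_lt[G _ _] _].
  have [i _ ari] := ar_infinitely_often 0%N 0%N.
  have no_arg (j : 'I_(ar i)) : False by case: j => j; rewrite ari.
  by apply: empty; exists (G i (fun j => False_rect _ (no_arg j))).
rewrite (_ : [set u | _] =
  [set u | exists m, check_number ar #|V| (facets K) p q r u m]).
  exact: check_number_re.
apply/seteqP; split=> [u [S /lambda_lt[G cG ltG] ->]|u [m /andP[above cert]]]; last first.
  exact: (certifies_sound K_complex b0 cert (approx_above_sound pqrP above)).
have ge0 : (0 <= lambda_algebra G [set` S])%E by apply: ereal_sup_ubound; left.
(* Finiteness turns this supremum into the real bound [alpha'] that [certifies_complete] takes. *)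
have finG : lambda_algebra G [set` S] \is a fin_num.
  by rewrite ge0_fin_numE // (lt_trans ltG) // ltry.
have [|||N [d [codes [eqs [tabs [N0 lt_a cert]]]]]] :=
  @certifies_complete R V K K_complex ar G cG b0 S alpha (fine (lambda_algebra G [set` S])).
- exact: fine_ge0.
- by rewrite -lte_fin fineK.
- move=> e a eS; rewrite -lee_fin fineK //; apply: ereal_sup_ubound; right.
  by exists e => //; exists a.
have [n above] := approx_above_complete pqrP N0 lt_a.
exact: check_number_surj above cert.
Qed.
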